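(* Let $E$ be a uniformly smooth and uniformly convex real Banach space with dual space $E^{*}$ and normalized duality map $J$, and let $C$ be a nonempty closed and convex subset of $E$ such that $JC$ is closed and convex. Let $\{f_i\}_{i=1}^{\infty}$ be a countable family of bifunctions from $JC\times JC$ to $\mathbb{R}$, each satisfying conditions (A1)-(A4) listed in the context; let $\{A_j\}_{j=1}^{\infty}$ be a countable family of continuous monotone mappings from $C$ into $E^{*}$; and let $\{T_n\}_{n=1}^{\infty}$ be a countable family of generalized $J_{*}$-nonexpansive maps from $C$ into $E^{*}$. Let $\Gamma$ be a family of $J_{*}$-closed and generalized $J_{*}$-nonexpansive maps from $C$ into $E^{*}$ such that $$\bigcap_{n=1}^{\infty}F_J(T_n)=F_J(\Gamma)\neq\emptyset .$$ Assume that $\{T_n\}$ satisfies the NST-condition with $\Gamma$, and suppose that the common solution set $$B:=F_J(\Gamma)\cap\Big[\bigcap_{i=1}^{\infty}EP(f_i)\Big]\cap\Big[\bigcap_{j=1}^{\infty}VI(C,A_j)\Big]$$ is nonempty, closed and convex. Let $\mu,\nu:\mathbb{N}\to\mathbb{N}$ be maps such that $\{n:\mu(n)=i\}$ and $\{n:\nu(n)=j\}$ are infinite for all $i,j\in\mathbb{N}$. Let $h:C\to C$ be a contraction with coefficient $\rho\in(0,1)$ and let $\bar u\in C$. Let $\{\lambda_n\},\{\sigma_n\}\subset[0,1)$ satisfy $\lambda_n+\sigma_n<1$ for all $n$, $\lambda_n\to0$ and $\sigma_n\to 0$. Let $\alpha_1,\alpha_2,\alpha_3\in(0,1)$ with $\alpha_1+\alpha_2+\alpha_3=1$,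 and let $\{r_n\}\subset[a,\infty)$ for some $a>0$. Starting from $x_1\in C$ and $C_1=C$, define for all $n\ge1$ $$\begin{aligned} s_n&=J^{-1}\big(\lambda_nJh(x_n)+\sigma_nJ\bar u+(1-\lambda_n-\sigma_n)Jx_n\big),\\ z_n&=\Big\{z\in C: f_{\mu(n)}(Jz,Jy)+\tfrac1{r_n}\langle y-z,Jz-Js_n\rangle\ge0\ \ \forall y\in C\Big\},\\ u_n&=\Big\{z\in C:\langle y-z,A_{\nu(n)}z\rangle+\tfrac1{r_n}\langle y-z,Jz-Js_n\rangle\ge0\ \ \forall y\in C\Big\},\\ y_n&=J^{-1}\big(\alpha_1Js_n+\alpha_2Jz_n+\alpha_3T_nu_n\big),\\ C_{n+1}&=\{v\in C_n:\phi(v,y_n)\le\phi(v,s_n)\},\\ x_{n+1}&=\Pi_{C_{n+1}}x_1 . \end{aligned}$$ Then the sequence $\{x_n\}$ is well defined and converges strongly to $\Pi_Bx_1$, the generalized projection of $x_1$ onto $B$.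
   Context: Notation. $\langle x,x^{*}\rangle$ is the pairing of $x\in E$ with $x^{*}\in E^{*}$. The normalized duality map is $Jx=\{x^{*}\in E^{*}:\langle x,x^{*}\rangle=\|x\|\|x^{*}\|,\ \|x\|=\|x^{*}\|\}$; for $E$ uniformly smooth and uniformly convex it is a single-valued bijection $E\to E^{*}$, and $J_{*}=J^{-1}:E^{*}\to E$. Lyapunov functional: $\phi(x,y)=\|x\|^2-2\langle x,Jy\rangle+\|y\|^2$ for $x,y\in E$. For a nonempty closed convex $K\subset E$ and $x\in E$, the generalized projection $\Pi_Kx$ is the unique point of $K$ with $\phi(\Pi_Kx,x)=\inf_{y\in K}\phi(y,x)$. $J$-fixed points: for $T:C\to E^{*}$, $F_J(T)=\{p\in C:Tp=Jp\}$; for a family $\Gamma$ of such maps, $F_J(\Gamma)=\bigcap_{T\in\Gamma}F_J(T)$. $T:C\to E^{*}$ is generalized $J_{*}$-nonexpansive if $F_J(T)\ne\emptyset$ and $\phi(p,(J_{*}\circ T)x)\le\phi(p,x)$ for all $x\in C$, $p\in F_J(T)$. $T$ is $J_{*}$-closed if whenever $x_n\to x$ and $(J_{*}\circ T)x_n\to y$ (with $x_n\in C$), then $(J_{*}\circ T)x=y$. NST-condition: given families $\{T_n\}$ and $\Gamma$ of generalized $J_{*}$-nonexpansive maps from $C$ into $E^{*}$ with $\bigcap_nF_J(T_n)=F_J(\Gamma)\ne\emptyset$, $\{T_n\}$ satisfies the NST-condition with $\Gamma$ if for each bounded sequence $\{x_n\}\subset C$, $\|Jx_n-T_nx_n\|\to0$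 implies $\|Jx_n-Tx_n\|\to0$ for all $T\in\Gamma$. Conditions on a bifunction $f:JC\times JC\to\mathbb{R}$: (A1) $f(x^{*},x^{*})=0$ for all $x^{*}\in JC$; (A2) $f(x^{*},y^{*})+f(y^{*},x^{*})\le0$ for all $x^{*},y^{*}\in JC$; (A3) $\limsup_{t\downarrow0}f(tz^{*}+(1-t)x^{*},y^{*})\le f(x^{*},y^{*})$ for all $x^{*},y^{*},z^{*}\in JC$; (A4) for each $x^{*}\in JC$, $f(x^{*},\cdot)$ is convex and lower semicontinuous. Solution sets: $EP(f)=\{x\in C:f(Jx,Jy)\ge0\ \forall y\in C\}$; for $A:C\to E^{*}$, $VI(C,A)=\{x\in C:\langle y-x,Ax\rangle\ge0\ \forall y\in C\}$. $A$ is monotone if $\langle x-y,Ax-Ay\rangle\ge0$ for all $x,y\in C$. Convention: ''$z_n=\{z\in C:\dots\}$'' and ''$u_n=\{z\in C:\dots\}$'' mean that the set on the right is a singleton whose unique element is $z_n$, respectively $u_n$.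
   Formalization: Added hypothesis: at each step actually reached, the set defining z_n is nonempty. Conditions (A1)-(A4) do not ensure this (it fails for E=C=l^p on R^2, p≠2, f(x*,y* )=<J_*x*,y*-x*>, s_n≠0); uniqueness of z_n, and existence and uniqueness of u_n and of the projections, are proved. *)

(* Defs.v *)
From HB Require Import structures.
From mathcomp Require Import all_boot all_order all_algebra.
From mathcomp Require Import all_classical all_reals all_analysis.

Set Implicit Arguments.
Unset Strict Implicit.
Unset Printing Implicit Defensive.

Import Order.TTheory GRing.Theory Num.Theory.
Import numFieldNormedType.Exports.

Local Open Scope classical_set_scope.
Local Open Scope ring_scope.

Section dual_space.
Context {R : realType} {E : normedModType R}.

Definition dual_pred : {pred E -> R^o} :=
  mem [set f : E -> R^o | linear f /\ continuous f].

Fact dual_submod_closed : submod_closed dual_pred.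
Proof.
split=> [|a f g].
  rewrite inE; split; last by move=> x; exact: cvg_cst.
  by move=> k x y /=; rewrite scaler0 addr0.
rewrite !inE => -[lf cf] [lg cg]; split.
  move=> k x y; rewrite /= !fctE lf lg !scalerDr !scalerA.
  by rewrite (mulrC a k) addrACA.
move=> x; apply: (@cvgD _ R^o); last exact: cg.
by apply: (@cvgZl_tmp _ R^o); exact: cf.
Qed.

HB.instance Definition _ :=
  GRing.isSubmodClosed.Build R (E -> R^o) dual_pred dual_submod_closed.

End dual_space.

(* The normed dual E^*: continuous linear functionals with the operator norm.
   The pairing <x, f> of x : E with f : dual E is the application f x. *)
Record dual (R : realType) (E : normedModType R) := Dual {
  dual_fun :> E -> R^o;
  dual_funP : dual_fun \in dual_pred
}.

HB.instance Definition _ (R : realType) (E : normedModType R) :=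
  [isSub for @dual_fun R E].
HB.instance Definition _ (R : realType) (E : normedModType R) :=
  [Choice of dual E by <:].
HB.instance Definition _ (R : realType) (E : normedModType R) :=
  [SubChoice_isSubLmodule of dual E by <:].

Section dual_norm.
Context {R : realType} {E : normedModType R}.
Implicit Types f g : dual E.

Definition dual_norm f : R := sup [set `|f x| | x in [set x : E | `|x| <= 1]].

Lemma dual_linear f : linear f.
Proof. by have := dual_funP f; rewrite inE => -[]. Qed.

Lemma dual_continuous f : continuous f.
Proof. by have := dual_funP f; rewrite inE => -[]. Qed.

HB.instance Definition _ f :=
  GRing.isLinear.Build R E R^o *:%R (dual_fun f) (dual_linear f).

Lemma dual_norm_has_sup f :
  has_sup [set `|f x| | x in [set x : E | `|x| <= 1]].
Proof.
split; first by exists `|f 0|, 0 => //=; rewrite normr0.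
have /linear_boundedP fb : bounded_near f (nbhs (0 : E)).
  by apply: continuous_linear_bounded; exact: dual_continuous.
have [r [r0 fr]] : exists r : R, 0 < r /\ forall x, `|f x| <= r * `|x|.
  near (+oo : set_system R) => r; exists r; split => //.
  by near: r; exact: fb.
exists r => _ [x /= x1 <-]; apply: (le_trans (fr x)).
by rewrite -[leRHS]mulr1 ler_wpM2l // ltW.
Unshelve. all: by end_near. Qed.

Lemma dual_norm_ub f x : `|x| <= 1 -> `|f x| <= dual_norm f.
Proof.
move=> x1; apply: ub_le_sup; first exact: (dual_norm_has_sup f).2.
by exists x.
Qed.

Lemma dual_norm_le f r : (forall x, `|x| <= 1 -> `|f x| <= r) ->
  dual_norm f <= r.
Proof.
move=> fr; apply: ge_sup; first exact: (dual_norm_has_sup f).1.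
by move=> _ [x /= x1 <-]; exact: fr.
Qed.

Lemma dual_norm_ge0 f : 0 <= dual_norm f.
Proof.
by apply: le_trans (dual_norm_ub f (x := 0) _); rewrite ?normr0.
Qed.

Lemma dual_normD f g : dual_norm (f + g) <= dual_norm f + dual_norm g.
Proof.
apply: dual_norm_le => x x1; apply: le_trans (ler_normD _ _) _.
by apply: lerD; exact: dual_norm_ub.
Qed.

Lemma dual_normZ_le (a : R) f : dual_norm (a *: f) <= `|a| * dual_norm f.
Proof.
apply: dual_norm_le => x x1.
rewrite (_ : (a *: f) x = a * f x) // normrM.
by rewrite ler_wpM2l //; exact: dual_norm_ub.
Qed.

Lemma dual_normZ (a : R) f : dual_norm (a *: f) = `|a| * dual_norm f.
Proof.
apply/eqP; rewrite eq_le dual_normZ_le /=.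
have [->|a0] := eqVneq a 0.
  by rewrite normr0 mul0r dual_norm_ge0.
rewrite -ler_pdivlMl ?normr_gt0 // -normfV.
have := dual_normZ_le a^-1 (a *: f).
by rewrite scalerA mulVf // scale1r.
Qed.

Lemma dual_norm0_eq0 f : dual_norm f = 0 -> f = 0.
Proof.
move=> f0; apply: val_inj; apply/funext => x /=.
have fB y : `|y| <= 1 -> f y = 0.
  by move=> /(dual_norm_ub f); rewrite f0 normr_le0 => /eqP.
have [->|x0] := eqVneq x 0; first by rewrite linear0.
have : f (`|x|^-1 *: x) = 0.
  by apply: fB; rewrite normrZ normfV normr_id mulVf // normr_eq0.
rewrite linearZ /= => /eqP; rewrite scaler_eq0 invr_eq0 normr_eq0.
by rewrite (negbTE x0) => /eqP.
Qed.

End dual_norm.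

HB.instance Definition _ (R : realType) (E : normedModType R) :=
  @Lmodule_isNormed.Build R (dual E) dual_norm
    dual_normD dual_normZ dual_norm0_eq0.

Section geometry.
Context {R : realType} (E : normedModType R).

Definition uniformly_convex : Prop :=
  forall e : R, 0 < e <= 2 -> exists2 d : R, 0 < d &
    forall x y : E, `|x| = 1 -> `|y| = 1 -> e <= `|x - y| ->
      `|2^-1 *: (x + y)| <= 1 - d.

Definition smoothness_modulus (t : R) : R :=
  sup [set r | exists x y : E,
    [/\ `|x| = 1, `|y| = t & r = 2^-1 * (`|x + y| + `|x - y|) - 1]].

Definition uniformly_smooth : Prop :=
  smoothness_modulus t / t @[t --> 0^'+] --> (0 : R).

End geometry.

Section duality_map.
Context {R : realType} {E : normedModType R}.
Implicit Types (C : set E) (T A : E -> dual E) (x y : E).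

Definition duality_set x : set (dual E) :=
  [set f : dual E | f x = `|x| * `|f| /\ `|x| = `|f|].

(* [J] and [Jinv] are total by a default value; when E is uniformly smooth and
   uniformly convex, [duality_set x] is a singleton and [J] is a bijection, so
   that the default is never used. *)
Definition J x : dual E := get (duality_set x).

Definition Jinv (f : dual E) : E := get [set x | J x = f].

Definition phi x y : R := `|x| ^+ 2 - 2 * J y x + `|y| ^+ 2.

(* The generalized projection of x onto K is p when this set is [set p]. *)
Definition gen_proj (K : set E) x : set E :=
  [set p | K p /\ phi p x = inf [set phi y x | y in K]].

Definition FJ C T : set E := [set p | C p /\ T p = J p].

Definition gen_Jstar_nonexpansive C T : Prop :=
  FJ C T !=set0 /\
  forall x p, C x -> FJ C T p -> phi p (Jinv (T x)) <= phi p x.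

Definition Jstar_closed C T : Prop :=
  forall (x_ : nat -> E) x y, (forall n, C (x_ n)) ->
    x_ n @[n --> \oo] --> x -> Jinv (T (x_ n)) @[n --> \oo] --> y ->
    Jinv (T x) = y.

Definition NST_condition C (T_ : nat -> E -> dual E) (Gamma : set (E -> dual E))
    : Prop :=
  forall x_ : nat -> E, (forall n, C (x_ n)) -> bounded_set (range x_) ->
    `|J (x_ n) - T_ n (x_ n)| @[n --> \oo] --> (0 : R) ->
    forall T, Gamma T -> `|J (x_ n) - T (x_ n)| @[n --> \oo] --> (0 : R).

Definition monotone_on C A : Prop :=
  forall x y, C x -> C y -> 0 <= (A x - A y) (x - y).

Definition VI C A : set E :=
  [set x | C x /\ forall y, C y -> 0 <= A x (y - x)].

Definition VI_resolvent C A (r : R) (s : E) : set E :=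
  [set z | C z /\ forall y, C y ->
    0 <= A z (y - z) + r^-1 * (J z - J s) (y - z)].

Implicit Type f : dual E -> dual E -> R.

(* Conditions (A1)-(A4) for a bifunction on K x K; only the values of f on
   K x K matter when K is convex. *)
Definition eq_bifunction (K : set (dual E)) f : Prop :=
  [/\ forall xs, K xs -> f xs xs = 0,
      forall xs ys, K xs -> K ys -> f xs ys + f ys xs <= 0,
      forall xs ys zs, K xs -> K ys -> K zs ->
        (limf_esup (fun t : R => (f (t *: zs + (1 - t) *: xs) ys)%:E) 0^'+
          <= (f xs ys)%:E)%E
    & forall xs, K xs -> convex_function K (f xs : dual E -> R^o) /\
        lower_semicontinuous (fun ys : subspace K => (f xs ys)%:E)].

Definition EP C f : set E :=
  [set x | C x /\ forall y, C y -> 0 <= f (J x) (J y)].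

(* Unlike [VI_resolvent], this set can be empty under (A1)-(A4): f is convex in
   the dual variable J y whereas the other term is affine in y. For instance,
   if E = C is l^p on R^2 with p <> 2 and f xs ys = (ys - xs) (Jinv xs), then
   [EP_resolvent C f r s] is empty as soon as s <> 0. *)
Definition EP_resolvent C f (r : R) (s : E) : set E :=
  [set z | C z /\ forall y, C y ->
    0 <= f (J z) (J y) + r^-1 * (J z - J s) (y - z)].

Definition common_solutions C (Gamma : set (E -> dual E))
    (f_ : nat -> dual E -> dual E -> R) (A_ : nat -> E -> dual E) : set E :=
  \bigcap_(T in Gamma) FJ C T
    `&` (\bigcap_i EP C (f_ i)) `&` (\bigcap_j VI C (A_ j)).

End duality_map.

Section scheme.
Context {R : realType} {E : normedModType R}.

Record iterates := Iterates {
  it_x : nat -> E;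
  it_s : nat -> E;
  it_z : nat -> E;
  it_u : nat -> E;
  it_y : nat -> E;
  it_C : nat -> set E
}.

Variables (C : set E) (h : E -> E) (ubar : E) (lambda sigma : nat -> R)
  (a1 a2 a3 : R) (r : nat -> R) (mu nu : nat -> nat)
  (f : nat -> dual E -> dual E -> R) (A T : nat -> E -> dual E) (x1 : E).

Definition scheme_s (n : nat) (x : E) : E :=
  Jinv (lambda n *: J (h x) + sigma n *: J ubar
        + (1 - lambda n - sigma n) *: J x).

(* The first N steps of the iteration, indexed from 0: [it_x w 0] is x_1 and
   [it_C w 0] is C_1 = C. The sequences are unconstrained beyond step N. *)
Definition scheme_upto (N : nat) (w : iterates) : Prop :=
  [/\ it_x w 0%N = x1, it_C w 0%N = C &
    forall n, (n < N)%N ->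
      [/\ it_s w n = scheme_s n (it_x w n),
          EP_resolvent C (f (mu n)) (r n) (it_s w n) = [set it_z w n],
          VI_resolvent C (A (nu n)) (r n) (it_s w n) = [set it_u w n],
          it_y w n = Jinv (a1 *: J (it_s w n) + a2 *: J (it_z w n)
                           + a3 *: T n (it_u w n)) &
          it_C w n.+1 =
            [set v | it_C w n v /\ phi v (it_y w n) <= phi v (it_s w n)] /\
          gen_proj (it_C w n.+1) x1 = [set it_x w n.+1] ]].

End scheme.

Arguments iterates {R} E.

(* Main.v *)
(* The smoothness of E makes the normalized duality map J single-valued and
   continuous. Uniform convexity and completeness let [|z|^2 - 2 f z] attain its
   minimum on closed convex sets; on the whole space this gives the surjectivity
   of J, on a subset the generalized projection, on a directed family of sets
   the finite intersection property behind the existence of u_n.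

   The sets C_n are closed, convex, decreasing and contain B, because
   [phi p y_n + a2 phi z_n s_n + a3 phi u_n s_n <= phi p s_n] for p in B.
   Projecting x_1 onto decreasing sets makes x_n Cauchy; let x be its limit.
   Then s_n tends to x, so does y_n as x_(n+1) lies in C_(n+1), and the
   inequality above forces phi z_n s_n and phi u_n s_n to tend to 0, whence z_n
   and u_n tend to x and T_n u_n to J x. The NST-condition and J_*-closedness
   put x in F_J(Gamma); letting n tend to infinity along the fibres of mu and nu
   puts x in every EP(f_i) and VI(C, A_j). Finally phi x_n x_1 <= phi q x_1 for
   all q in B identifies x with the projection of x_1 onto B. *)

Require Import Defs.
From mathcomp Require Import all_boot all_order all_algebra.
From mathcomp Require Import all_classical all_reals all_analysis.
From mathcomp Require Import ring lra.

Set Implicit Arguments.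
Unset Strict Implicit.
Unset Printing Implicit Defensive.

Import Order.TTheory GRing.Theory Num.Theory.
Import numFieldNormedType.Exports.

Local Open Scope classical_set_scope.
Local Open Scope ring_scope.

Lemma le0_of_small (R : realFieldType) (a b : R) :
  (forall t, 0 < t -> t <= 1 -> a <= t * b) -> a <= 0.
Proof.
move=> H; apply/ler_addgt0Pr => e e0; rewrite add0r.
have b1 : 0 < `|b| + 1 by rewrite ltr_wpDl.
pose t := Num.min 1 (e / (`|b| + 1)).
have t0 : 0 < t by rewrite lt_min ltr01 divr_gt0.
apply: (le_trans (H t t0 _)); first by rewrite ge_min lexx.
apply: (@le_trans _ _ (t * (`|b| + 1))).
  by rewrite ler_pM2l// (le_trans (ler_norm b))// lerDl.
by rewrite -ler_pdivlMr// ge_min lexx orbT.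
Qed.

Section dual_pairing.
Context {R : realType} {E : normedModType R}.
Implicit Types (f g : dual E) (x y : E).

Lemma dualD f g x : (f + g) x = f x + g x. Proof. by []. Qed.
Lemma dualB f g x : (f - g) x = f x - g x. Proof. by []. Qed.
Lemma dualZ (a : R) f x : (a *: f) x = a * f x. Proof. by []. Qed.
Lemma pairD f x y : f (x + y) = f x + f y. Proof. exact: linearD. Qed.
Lemma pairB f x y : f (x - y) = f x - f y. Proof. exact: linearB. Qed.
Lemma pairZ f (a : R) x : f (a *: x) = a * f x. Proof. exact: linearZ. Qed.

Lemma pair_norm f x : `|f x| <= `|f| * `|x|.
Proof.
have [->|x0] := eqVneq x 0; first by rewrite linear0 !normr0 mulr0.
have := @dual_norm_ub _ _ f (`|x|^-1 *: x).
rewrite pairZ normrM normrZ normfV normr_id mulVf ?normr_eq0// => /(_ (lexx _)).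
by rewrite mulrC ler_pdivrMr// normr_gt0.
Qed.

Lemma pair_le f x : f x <= `|f| * `|x|.
Proof. exact: le_trans (ler_norm _) (pair_norm f x). Qed.

Lemma norm_dual_le f (M : R) : 0 <= M -> (forall x, f x <= M * `|x|) ->
  `|f| <= M.
Proof.
move=> M0 fM; apply: dual_norm_le => x x1.
apply: (@le_trans _ _ (M * `|x|)); last by rewrite ler_piMr.
by have := fM (- x); rewrite linearN normrN ler_norml fM andbT lerNl.
Qed.

End dual_pairing.

Section convex_combinations.
Context {R : realType} {E : normedModType R}.

Lemma convex_setE (K : set E) (x y : E) (t : R) : @convex_set R E K ->
  K x -> K y -> 0 <= t <= 1 -> K (t *: x + (1 - t) *: y).
Proof.
move=> cK /mem_set Kx /mem_set Ky t01.
have it : Itv.spec (@Itv.num_sem R) (Itv.Real `[0%Z, 1%Z]) t.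
  by rewrite /= /Itv.num_sem /= realE in_itv/= t01; case/andP: t01 => ->.
exact/set_mem/(cK x y (Itv.mk it)).
Qed.

Lemma norm_conv_sqr (x y : E) (t : R) : 0 <= t <= 1 ->
  `|t *: x + (1 - t) *: y| ^+ 2 <= t * `|x| ^+ 2 + (1 - t) * `|y| ^+ 2.
Proof.
move=> /andP[t0 t1].
have le : `|t *: x + (1 - t) *: y| <= t * `|x| + (1 - t) * `|y|.
  apply: le_trans (ler_normD _ _) _.
  by rewrite !normrZ !ger0_norm ?subr_ge0.
have := normr_ge0 (t *: x + (1 - t) *: y).
have := normr_ge0 x; have := normr_ge0 y; move: le.
move: `|_ + _| `|x| `|y| => w a b le b0 a0 w0.
apply: (@le_trans _ _ ((t * a + (1 - t) * b) ^+ 2)).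
  by rewrite ler_pXn2r ?nnegrE// (le_trans w0 le).
have -> : t * a ^+ 2 + (1 - t) * b ^+ 2 =
    (t * a + (1 - t) * b) ^+ 2 + t * (1 - t) * (a - b) ^+ 2 by ring.
by rewrite lerDl; apply: mulr_ge0; rewrite ?sqr_ge0// mulr_ge0 ?subr_ge0.
Qed.

Lemma cvg_segment (x y : E) : t *: x + (1 - t) *: y @[t --> (0 : R)^'+] --> y.
Proof.
have t0 : t @[t --> (0 : R)^'+] --> (0 : R) by exact: cvg_at_right_filter
  cvg_id.
rewrite -[X in _ --> X]add0r -[X in _ --> X + _](scale0r x).
rewrite -[X in _ --> _ + X]scale1r -[X in _ --> _ + X *: _](subr0 1).
apply: cvgD; apply: cvgZr_tmp => //.
by apply: cvgB => //; exact: cvg_cst.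
Qed.

End convex_combinations.

(** * Uniform convexity *)

Section uniform_convexity.
Context {R : realType} {E : normedModType R}.
Hypothesis E_uc : uniformly_convex E.
Implicit Types x y z : E.

Lemma uniformly_convex_sqr (M e : R) : 0 < e -> exists2 d : R, 0 < d &
  forall x y, `|x| <= M -> `|y| <= M -> e <= `|x - y| ->
    `|2^-1 *: (x + y)| ^+ 2 <= 2^-1 * (`|x| ^+ 2 + `|y| ^+ 2) - d.
Proof.
move=> e0.
pose N := `|M| + e.
have N0 : 0 < N by rewrite /N ltr_wpDl.
have MN : M <= N by rewrite /N (le_trans (ler_norm M))// lerDl ltW.
have eN : e <= N by rewrite /N lerDr.
have [|d0 d0_gt0 ucd] := @E_uc (e / (2 * N)).
  by rewrite divr_gt0 ?mulr_gt0//= ler_pdivrMr ?mulr_gt0//; lra.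
pose d := Num.min d0 1.
have d_gt0 : 0 < d by rewrite lt_min d0_gt0 ltr01.
have d_le1 : d <= 1 by rewrite ge_min lexx orbT.
have {}ucd x y : `|x| = 1 -> `|y| = 1 -> e / (2 * N) <= `|x - y| ->
    `|2^-1 *: (x + y)| <= 1 - d.
  by move=> x1 y1 /(ucd _ _ x1 y1) /le_trans; apply;
    rewrite lerD2l lerN2 ge_min lexx.
exists (e ^+ 2 / 64 * d); first by rewrite !mulr_gt0 ?invr_gt0 ?exprn_gt0.
move=> x y; wlog ba : x y / `|y| <= `|x|.
  move=> W xM yM exy; case: (leP `|y| `|x|) => [ba|/ltW ab]; first exact: W.
  by rewrite addrC [X in 2^-1 * X]addrC; apply: W => //; rewrite distrC.
move=> xM yM exy.
have xN := le_trans xM MN.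
set w := `|2^-1 *: _|.
have w0 : 0 <= w by exact: normr_ge0.
have wab : w <= 2^-1 * (`|x| + `|y|).
  by rewrite /w normrZ ger0_norm ?invr_ge0// ler_wpM2l ?invr_ge0// ler_normD.
have b0 : 0 <= `|y| by [].
have eab : e <= `|x| + `|y| := le_trans exy (ler_normB x y).
have [far|near] := leP (e / 4) (`|x| - `|y|).
  apply: (@le_trans _ _ ((2^-1 * (`|x| + `|y|)) ^+ 2)).
    by rewrite ler_pXn2r ?nnegrE// (le_trans w0 wab).
  have : (e / 4) ^+ 2 <= (`|x| - `|y|) ^+ 2.
    by rewrite ler_pXn2r ?nnegrE//; lra.
  have : e ^+ 2 / 64 * d <= e ^+ 2 / 64.
    by rewrite ler_piMr// divr_ge0// exprn_ge0// ltW.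
  by move: (e ^+ 2 / 64 * d) => c; lra.
have be : e / 4 <= `|y| by lra.
have y_gt0 : 0 < `|y| by lra.
have x_gt0 : 0 < `|x| by lra.
pose x' := `|x|^-1 *: x; pose y' := `|y|^-1 *: y.
have xE : x = `|x| *: x' by rewrite scalerA mulfV ?scale1r ?gt_eqF.
have yE : y = `|y| *: y' by rewrite scalerA mulfV ?scale1r ?gt_eqF.
have x'1 : `|x'| = 1 by rewrite normrZ normfV normr_id mulVf ?gt_eqF.
have y'1 : `|y'| = 1 by rewrite normrZ normfV normr_id mulVf ?gt_eqF.
clearbody x' y'.
have exy' : e / (2 * N) <= `|x' - y'|.
  have : `|x - y| <= `|x| * `|x' - y'| + (`|x| - `|y|).
    have -> : x - y = `|x| *: (x' - y') + (`|x| - `|y|) *: y'.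
      by rewrite {1}xE {1}yE scalerBr scalerBl addrA subrK.
    apply: le_trans (ler_normD _ _) _.
    by rewrite !normrZ normr_id y'1 mulr1 (@ger0_norm _ (_ - _)) ?subr_ge0.
  have : `|x| * `|x' - y'| <= N * `|x' - y'| by rewrite ler_wpM2r.
  rewrite ler_pdivrMr ?mulr_gt0//; move: `|x' - y'| => c; lra.
have {}ucd := ucd _ _ x'1 y'1 exy'.
have wd : w <= 2^-1 * (`|x| + `|y|) - `|y| * d.
  have -> : w =
      `|(`|y| *: (2^-1 *: (x' + y')) + (2^-1 * (`|x| - `|y|)) *: x')|.
    rewrite scalerA (mulrC `|y|) -!scalerA -scalerDr /w; congr (`|_ *: _|).
    by rewrite {1}xE {1}yE scalerBl scalerDr addrAC (addrC (`|y| *: x')) subrK.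
  apply: le_trans (ler_normD _ _) _.
  rewrite (normrZ `|y|) normr_id (normrZ (2^-1 * _)) x'1 mulr1.
  rewrite (@ger0_norm _ (2^-1 * _)); last by rewrite mulr_ge0 ?subr_ge0.
  by have := ler_wpM2l b0 ucd; lra.
have : w ^+ 2 <= (2^-1 * (`|x| + `|y|) - `|y| * d) ^+ 2.
  by rewrite ler_pXn2r ?nnegrE// (le_trans w0 wd).
have : (e / 4) ^+ 2 * d <= `|y| ^+ 2 * d.
  by rewrite ler_pM2r// ler_pXn2r ?nnegrE//; lra.
move: (w ^+ 2) ba => w2.
move: `|x| `|y| {wab wd w w0 eab near be y_gt0 x_gt0 ucd exy' x'1 y'1
  xE yE x' y' xM yM exy xN} b0 => a b b0 ba.
move=> ed wd.
have sq : 0 <= (a - b) ^+ 2 by exact: sqr_ge0.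
have bad : 0 <= b * (a - b) * d by rewrite !mulr_ge0 ?subr_ge0// ltW.
have b2 : 0 <= b ^+ 2 * d * (1 - d) by apply: mulr_ge0; [apply: mulr_ge0;
  rewrite ?sqr_ge0// ltW|rewrite subr_ge0].
have e2 : 0 <= e ^+ 2 * d by rewrite mulr_ge0 ?sqr_ge0// ltW.
lra.
Qed.

End uniform_convexity.

Section quadratic_minimization.
Context {R : realType} {E : completeNormedModType R}.
Hypothesis E_uc : uniformly_convex E.
Implicit Types (x y z : E) (K : set E) (g : dual E).

Definition shifted_sqr g z : R := `|z| ^+ 2 - 2 * g z.

Lemma shifted_sqr_ge g z : - `|g| ^+ 2 <= shifted_sqr g z.
Proof.
have := pair_le g z; rewrite /shifted_sqr.
have := sqr_ge0 (`|g| - `|z|); move: `|g| `|z| (g z) => a b c; nra.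
Qed.

Lemma shifted_sqr_bound g (d : R) z : shifted_sqr g z <= d ->
  `|z| <= 2 * `|g| + `|d| + 1.
Proof.
have := pair_le g z; have := ler_norm d; rewrite /shifted_sqr.
have := normr_ge0 z; have := normr_ge0 g; have := normr_ge0 d.
move: `|g| `|z| `|d| (g z) => a b c e; nra.
Qed.

Lemma continuous_shifted_sqr g : continuous (shifted_sqr g).
Proof.
move=> z; apply: cvgB; last by apply: cvgMr; exact: dual_continuous.
by rewrite expr2; apply: cvgM; exact: norm_continuous.
Qed.

(* By uniform convexity the almost-minimizers of the members of D generate a
   Cauchy filter. This replaces weak compactness throughout: D may be a single
   set, or the finite intersections of a family. *)
Lemma convex_family_min (D : set (set E)) g (M : R) :
  D !=set0 -> (forall K, D K -> closed K) ->
  (forall K, D K -> @convex_set R E K) ->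
  (forall K1 K2, D K1 -> D K2 -> exists2 K, D K & K `<=` K1 `&` K2) ->
  (forall K, D K -> exists2 z, K z & shifted_sqr g z <= M) ->
  exists d z, [/\ forall K, D K -> K z, shifted_sqr g z <= d &
    forall e, 0 < e ->
      exists2 K, D K & forall w, K w -> d - e < shifted_sqr g w].
Proof.
move=> [K0 DK0] Dcl Dcv Ddir DM.
pose S := [set m : R | exists2 K, D K & forall w, K w -> m <= shifted_sqr g w].
have supS : has_sup S.
  split; first by exists (- `|g| ^+ 2), K0 => // w _; exact: shifted_sqr_ge.
  by exists M => m [K DK mK]; have [z Kz zM] := DM K DK;
    exact: le_trans (mK z Kz) zM.
pose d := sup S.
have d_adh (e : R) : 0 < e -> exists2 K, D K & forall w, K w -> d - e <
  shifted_sqr g w.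
  move=> /sup_adherent /(_ supS)[m [K DK mK] dm]; exists K => // w /mK.
  exact: lt_le_trans.
have near_d K (e : R) : D K -> 0 < e -> exists2 w, K w & shifted_sqr g w < d +
  e.
  move=> DK e0; apply: contrapT => noW.
  have : S (d + e).
    by exists K => // w Kw; rewrite leNgt; apply/negP => we; apply: noW;
      exists w.
  by move/(ub_le_sup supS.2); rewrite -/d gerDl leNgt e0.
pose I := [set p : set E * R | D p.1 /\ 0 < p.2].
pose L (p : set E * R) := [set z | p.1 z /\ shifted_sqr g z < d + p.2].
pose F := filter_from I L.
have FF : ProperFilter F.
  apply: filter_from_proper; last first.
    by move=> [K e] [/= DK e0]; have [w] := near_d K e DK e0; exists w.
  apply: filter_from_filter; first by exists (K0, 1); split => //=.
  move=> [K1 e1] [K2 e2] [/= D1 e10] [/= D2 e20].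
  have [K DK sK] := Ddir _ _ D1 D2.
  exists (K, Num.min e1 e2); first by split => //=; rewrite lt_min e10.
  move=> w [/= /sK[K1w K2w]]; rewrite -ltrBlDl lt_min.
  by move=> /andP[w1 w2]; split; split => //=; rewrite -ltrBlDl.
have Fcauchy : cauchy F.
  apply: cauchy_exP => e e0.
  have [c c0 uc] := uniformly_convex_sqr E_uc (2 * `|g| + `|d + 1| + 1) e0.
  pose t := Num.min (c / 2) 1.
  have t0 : 0 < t by rewrite lt_min ltr01 andbT divr_gt0.
  have t1 : t <= 1 by rewrite ge_min lexx orbT.
  have tc : t <= c / 2 by rewrite ge_min lexx.
  have [K DK Kd] := d_adh t t0.
  have [x Kx xd] := near_d K t DK t0.
  exists x, (K, t) => // z [/= Kz zd].
  rewrite -ball_normE /ball_/= ltNge; apply/negP => exz.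
  have := uc x z; rewrite !(@shifted_sqr_bound g (d + 1)) /shifted_sqr;
    first last.
  - by apply/ltW/(lt_le_trans xd); rewrite lerD2l.
  - by apply/ltW/(lt_le_trans zd); rewrite lerD2l.
  move=> /(_ isT isT exz).
  have : K (2^-1 *: (x + z)).
    have := convex_setE (Dcv K DK) Kx Kz (t := 2^-1).
    by rewrite scalerDr (_ : 1 - 2^-1 = 2^-1 :> R); [apply; lra|lra].
  move/Kd; rewrite /shifted_sqr pairZ pairD.
  move: xd zd; rewrite /shifted_sqr; lra.
have Fcvg : F --> lim F by exact: cauchy_cvg.
exists d, (lim F); split => //.
  move=> K DK; apply: (@closed_cvg _ _ F _ id K _ _ _ Fcvg); first exact: Dcl.
  by exists (K, 1) => // z [].
apply/ler_addgt0Pr => e e0.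
have cl : closed [set y : R | y <= d + e] by exact: closed_le.
apply: (@closed_cvg _ _ F _ (shifted_sqr g) [set y : R | y <= d + e] cl).
- by exists (K0, e) => // z [_ /= /ltW].
- by apply: (@continuous_cvg _ _ _ F _ id (shifted_sqr g)) Fcvg;
  exact: continuous_shifted_sqr.
Qed.

Lemma convex_min K g : K !=set0 -> closed K -> @convex_set R E K ->
  exists2 z, K z & forall w, K w -> shifted_sqr g z <= shifted_sqr g w.
Proof.
move=> [z0 Kz0] cK vK.
have [|||||d [z [Kz zd dK]]] := @convex_family_min [set K] g (shifted_sqr g z0).
- by exists K.
- by move=> _ ->.
- by move=> _ ->.
- by move=> _ _ -> ->; exists K.
- by move=> _ ->; exists z0.
exists z => [|w Kw]; first exact: Kz.
apply: le_trans zd _; apply/ler_addgt0Pr => e /dK[_ -> /(_ w Kw)].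
by rewrite ltrBlDr => /ltW.
Qed.

End quadratic_minimization.

(** * The duality map *)

Lemma dual_of_bounded (R : realType) (E : normedModType R) (L : E -> R) (M : R)
  :
  (forall a x y, L (a *: x + y) = a * L x + L y) ->
  (forall x, L x <= M * `|x|) -> exists f : dual E, forall x, f x = L x.
Proof.
move=> Llin LM.
have LE : linear (L : E -> R^o) by move=> a x y; exact: Llin.
have L0 : L 0 = 0 by have := Llin 1 0 0; rewrite scaler0 addr0; lra.
have LB x y : L (x - y) = L x - L y.
  by rewrite addrC -scaleN1r Llin mulN1r addrC.
have LM' x : `|L x| <= M * `|x|.
  by have := LM (- x); rewrite -(sub0r x) LB L0 sub0r sub0r normrN ler_norml LM
    andbT lerNl.
have M0 (x : E) : 0 <= M * `|x| by exact: (le_trans (normr_ge0 (L x)) (LM' x)).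
have Lcont : continuous (L : E -> R^o).
  move=> x; apply/cvgrPdist_le => /= e e0.
  near=> y; rewrite -LB; apply: le_trans (LM' _) _.
  apply: (@le_trans _ _ ((`|M| + 1) * `|x - y|)).
    by rewrite ler_wpM2r// (le_trans (ler_norm M))// lerDl.
  rewrite mulrC -ler_pdivlMr ?ltr_wpDl//.
  near: y; apply: cvgr_dist_le; first exact: cvg_id.
  by rewrite divr_gt0// ltr_wpDl.
have LP : (L : E -> R^o) \in @dual_pred R E by rewrite inE.
by exists (Dual LP).
Unshelve. all: by end_near. Qed.

Lemma duality_set_of_le (R : realType) (E : normedModType R) (x : E)
    (f : dual E) : `|f| <= `|x| -> `|x| ^+ 2 <= f x -> duality_set x f.
Proof.
move=> fx xf; have fxx := pair_le f x.
have xE : `|x| = `|f|.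
  apply/eqP; rewrite eq_le fx andbT; have [x0|x0] := eqVneq `|x| 0.
    by rewrite x0.
  have x_gt0 : 0 < `|x| by rewrite lt_def x0 /=.
  by rewrite -(ler_pM2r x_gt0) -expr2 (le_trans xf).
split => //; rewrite -xE -expr2; apply/eqP; rewrite eq_le xf andbT.
by move: fxx; rewrite -xE -expr2.
Qed.

Section smooth_norm.
Context {R : realType} {E : normedModType R}.
Hypothesis E_us : uniformly_smooth E.
Implicit Types (x y z : E) (f g : dual E).

Lemma smooth_sqr_diff x (e : R) : 0 < e -> exists2 d : R, 0 < d &
  forall y, `|y| <= d ->
    `|x + y| ^+ 2 + `|x - y| ^+ 2 - 2 * `|x| ^+ 2 <= e * `|y|.
Proof.
move=> e0; have [->|x0] := eqVneq x 0.
  exists (e / 2) => [|y yd]; first by rewrite divr_gt0.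
  rewrite add0r sub0r normrN normr0; have := normr_ge0 y; nra.
pose c := `|x|; have c0 : 0 < c by rewrite normr_gt0.
pose eta := e / (8 * c).
have eta0 : 0 < eta by rewrite divr_gt0// mulr_gt0.
have /cvgrPdist_lt/(_ eta eta0)/nbhs_ballP[d0 /= d00 Hd] := E_us.
exists (Num.min (e / 4) (c * d0 / 2)).
  by rewrite lt_min !divr_gt0//= mulr_gt0.
move=> y; rewrite le_min => /andP[ye yd].
have [->|y0] := eqVneq y 0.
  by rewrite addr0 subr0 normr0 mulr0; lra.
have t0 : 0 < `|y| by rewrite normr_gt0.
have s0 : 0 < `|y| / c by rewrite divr_gt0.
have /Hd/(_ s0) : ball (0 : R) d0 (`|y| / c).
  rewrite -ball_normE /ball_/= sub0r normrN ger0_norm ?ltW//.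
  rewrite ltr_pdivrMr//; have : 0 < c * d0 by rewrite mulr_gt0.
  by move: yd; rewrite mulrC; lra.
rewrite sub0r normrN => /(le_lt_trans (ler_norm _)).
rewrite ltr_pdivrMr// => rho_lt.
have : 2^-1 * (`|c^-1 *: x + c^-1 *: y| + `|c^-1 *: x - c^-1 *: y|) - 1 <=
    smoothness_modulus E (`|y| / c).
  apply: ub_le_sup; last first.
    exists (c^-1 *: x), (c^-1 *: y); split => //.
      by rewrite normrZ normfV normr_id mulVf// gt_eqF.
    by rewrite normrZ normfV normr_id mulrC.
  exists (`|y| / c) => _ [x' [y' [x1 y1 ->]]].
  have := ler_normD x' y'; have := ler_normB x' y'; rewrite x1 y1; lra.
move=> /le_lt_trans/(_ rho_lt).
rewrite -scalerDr -scalerBr !normrZ normfV normr_id.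
have -> : eta * (`|y| / c) = e * `|y| / (8 * c ^+ 2).
  by rewrite /eta; field; rewrite gt_eqF.
rewrite -/c -mulrDr.
have le1 := ler_normD x y; have le2 := ler_normB x y.
have le3 := lerB_normD x y; have le4 := lerB_dist x y.
rewrite -/c in le1 le2 le3 le4 *.
move: `|x + y| `|x - y| `|y| le1 le2 le3 le4 t0 ye {yd y0 s0 rho_lt} => a b t.
move=> act bct cat_ cbt t0 te.
rewrite ltr_pdivlMr ?mulr_gt0 ?exprn_gt0//.
have -> : (2^-1 * (c^-1 * (a + b)) - 1) * (8 * c ^+ 2) = 4 * c * (a + b) - 8 *
  c ^+ 2.
  by field; rewrite gt_eqF.
have : (a - c) ^+ 2 <= t ^+ 2.
  by rewrite -real_normK ?num_real// ler_pXn2r ?nnegrE ?(ltW t0)// ler_norml;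
    lra.
have : (b - c) ^+ 2 <= t ^+ 2.
  by rewrite -real_normK ?num_real// ler_pXn2r ?nnegrE ?(ltW t0)// ler_norml;
    lra.
have : t * t <= e / 4 * t by rewrite ler_pM2r.
nra.
Qed.

Section directional_derivative.
Variable x : E.

Let quot y (t : R) : R := (`|x + t *: y| ^+ 2 - `|x| ^+ 2) / (2 * t).

Let quot_ge y t : 0 < t -> - (`|x| * `|y|) <= quot y t.
Proof.
move=> t0; rewrite /quot ler_pdivlMr ?mulr_gt0//.
have := ler_normD (x + t *: y) (- (t *: y)); rewrite addrK normrN.
rewrite normrZ gtr0_norm//.
have : 0 <= t * `|y| by rewrite mulr_ge0// ltW.
have := normr_ge0 x; have := normr_ge0 (x + t *: y).
rewrite (_ : - (`|x| * `|y|) * (2 * t) = - (2 * `|x| * (t * `|y|)));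
  last by ring.
move: (t * `|y|) `|x| `|_ + _| => ty a b b0 a0 ty0 le.
have [tya|aty] := leP ty a.
  have : (a - ty) ^+ 2 <= b ^+ 2 by rewrite ler_pXn2r ?nnegrE ?subr_ge0//; lra.
  by have := sqr_ge0 ty; lra.
have : a * a <= a * ty by rewrite ler_wpM2l// ltW.
have : 0 <= a * ty by rewrite mulr_ge0.
by have := sqr_ge0 b; lra.
Qed.

Let quot_mono y s t : 0 < s -> s <= t -> quot y s <= quot y t.
Proof.
move=> s0 st; have t0 : 0 < t by exact: lt_le_trans st.
have st01 : 0 <= s / t <= 1 by rewrite divr_ge0 ?(ltW s0) ?(ltW t0)//=
  ler_pdivrMr// mul1r.
have := norm_conv_sqr (x + t *: y) x st01.
have -> : (s / t) *: (x + t *: y) + (1 - s / t) *: x = x + s *: y.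
  by rewrite scalerDr scalerA divfK ?gt_eqF// addrAC -scalerDl
    (addrC (s / t)) subrK scale1r.
rewrite /quot ler_pdivrMr ?mulr_gt0// => le.
rewrite (_ : _ / (2 * t) * (2 * s) = s / t * (`|x + t *: y| ^+ 2 - `|x| ^+ 2)).
  by move: le; rewrite mulrBl mulrBr; lra.
by field; rewrite gt_eqF.
Qed.

Let dq y : R := inf [set quot y t | t in [set t | 0 < t]].

Let dq_has_inf y : has_inf [set quot y t | t in [set t | 0 < t]].
Proof.
split; first by exists (quot y 1), 1 => //=.
by exists (- (`|x| * `|y|)) => _ [t /= t0 <-]; exact: quot_ge.
Qed.

Let dq_le y t : 0 < t -> dq y <= quot y t.
Proof. by move=> t0; apply: ge_inf; [exact: (dq_has_inf y).2|exists t]. Qed.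

Let le_dq y m : (forall t, 0 < t -> m <= quot y t) -> m <= dq y.
Proof.
move=> mq; apply: lb_le_inf; first exact: (dq_has_inf y).1.
by move=> _ [t /= t0 <-]; exact: mq.
Qed.

Let dq_adh y e : 0 < e -> exists2 s, 0 < s &
  forall t, 0 < t -> t <= s -> quot y t < dq y + e.
Proof.
move=> /inf_adherent/(_ (dq_has_inf y))[_ [s /= s0 <-] se].
by exists s => // t t0 ts; apply: le_lt_trans se; exact: quot_mono.
Qed.

Let dqD y z : dq (y + z) <= dq y + dq z.
Proof.
apply/ler_addgt0Pr => e e0.
have e2 : 0 < e / 2 by rewrite divr_gt0.
have [s s0 sy] := dq_adh y e2; have [t t0 tz] := dq_adh z e2.
pose u := Num.min s t.
have u0 : 0 < u by rewrite lt_min s0.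
have := sy u u0; rewrite ge_min lexx => /(_ isT) uy.
have := tz u u0; rewrite ge_min lexx orbT => /(_ isT) uz.
have u20 : 0 < u / 2 by rewrite divr_gt0.
have := dq_le (y + z) u20.
suff : quot (y + z) (u / 2) <= quot y u + quot z u by lra.
rewrite /quot -mulrDl ler_pdivrMr ?mulr_gt0//.
have h01 : 0 <= (2^-1 : R) <= 1 by lra.
have := norm_conv_sqr (x + u *: y) (x + u *: z) h01.
have -> : 1 - 2^-1 = 2^-1 :> R by lra.
have -> : 2^-1 *: (x + u *: y) + 2^-1 *: (x + u *: z) = x + (u / 2) *: (y + z).
  rewrite !scalerDr !scalerA addrACA -scalerDl (_ : 2^-1 + 2^-1 = 1 :> R);
    last by lra.
  by rewrite scale1r (mulrC u).
set c := `|_ + (u / 2) *: _| ^+ 2.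
rewrite (_ : _ / (2 * u) * (2 * (u / 2)) = (`|x + u *: y| ^+ 2 + `|x + u *: z|
  ^+ 2 - 2 * `|x| ^+ 2) / 2).
  by lra.
by field; rewrite gt_eqF.
Qed.

Let dqN_le y : dq y + dq (- y) <= 0.
Proof.
rewrite -[leRHS](addr0 0); apply/ler_addgt0Pr => e e0; rewrite add0r.
have ey : 0 < e / (`|y| + 1) by rewrite divr_gt0// ltr_wpDl.
have [d d0 dP] := smooth_sqr_diff x ey.
pose t := d / (`|y| + 1).
have t0 : 0 < t by rewrite divr_gt0// ltr_wpDl.
have ty : `|t *: y| = t * `|y| by rewrite normrZ gtr0_norm.
have y1 : `|y| / (`|y| + 1) <= 1 by rewrite ler_pdivrMr ?ltr_wpDl// mul1r lerDl.
have : `|t *: y| <= d.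
  rewrite ty /t -mulrA (mulrC _^-1) -[leRHS]mulr1.
  by rewrite ler_wpM2l ?(ltW d0).
move/dP; rewrite ty => le.
have := dq_le y t0; have := dq_le (- y) t0.
suff : quot y t + quot (- y) t <= e by lra.
rewrite /quot scalerN -mulrDl ler_pdivrMr ?mulr_gt0//.
have : e / (`|y| + 1) * (t * `|y|) <= e * t.
  rewrite (_ : _ * _ = e * t * (`|y| / (`|y| + 1))); last by ring.
  by rewrite -[leRHS]mulr1 ler_wpM2l// mulr_ge0 ?ltW.
have : 0 <= e * t by rewrite mulr_ge0 ?ltW.
lra.
Qed.

Let dq0 : dq 0 = 0.
Proof.
have q0 t : quot 0 t = 0 by rewrite /quot scaler0 addr0 subrr mul0r.
apply/eqP; rewrite eq_le -{1}(q0 1) dq_le//=.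
by apply: le_dq => t _; rewrite q0.
Qed.

Let dqN y : dq (- y) = - dq y.
Proof. by have := dqN_le y; have := dqD y (- y); rewrite addrN dq0; lra. Qed.

Let dq_add y z : dq (y + z) = dq y + dq z.
Proof.
apply/eqP; rewrite eq_le dqD/=.
by have := dqD (y + z) (- z); rewrite addrK dqN; lra.
Qed.

Let dqZ_le y a : 0 < a -> dq (a *: y) <= a * dq y.
Proof.
move=> a0; rewrite mulrC -ler_pdivrMr//; apply: le_dq => t t0.
rewrite ler_pdivrMr//.
have -> : quot y t * a = quot (a *: y) (t / a).
  by rewrite /quot scalerA divfK ?gt_eqF//; field; rewrite !gt_eqF.
by rewrite dq_le// divr_gt0.
Qed.

Let dqZ y a : dq (a *: y) = a * dq y.
Proof.
have pos b : 0 < b -> dq (b *: y) = b * dq y.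
  move=> b0; apply/eqP; rewrite eq_le dqZ_le//=.
  have : 0 < b^-1 by rewrite invr_gt0.
  move=> /(dqZ_le (b *: y)); rewrite scalerA mulVf ?gt_eqF// scale1r.
  by rewrite ler_pdivlMl.
have [a0|a0|->] := ltgtP a 0; last by rewrite scale0r dq0 mul0r.
- by rewrite -[a]opprK scaleNr dqN pos ?oppr_gt0// !mulNr.
- exact: pos.
Qed.

Let dq_norm y : dq y <= `|x| * `|y|.
Proof.
rewrite -subr_le0; apply: (@le0_of_small _ _ (`|y| ^+ 2 / 2)) => t t0 _.
rewrite lerBlDr; apply: le_trans (dq_le y t0) _.
rewrite /quot ler_pdivrMr ?mulr_gt0//.
have : `|x + t *: y| ^+ 2 <= (`|x| + t * `|y|) ^+ 2.
  rewrite ler_pXn2r ?nnegrE ?addr_ge0 ?mulr_ge0 ?(ltW t0)//.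
  by apply: le_trans (ler_normD _ _) _; rewrite normrZ gtr0_norm.
lra.
Qed.

Let dq_self : `|x| ^+ 2 <= dq x.
Proof.
apply: le_dq => t t0; rewrite /quot ler_pdivlMr ?mulr_gt0//.
rewrite -{2}[x]scale1r -scalerDl normrZ gtr0_norm ?addr_gt0//.
have : 0 <= t ^+ 2 * `|x| ^+ 2 by rewrite mulr_ge0 ?sqr_ge0.
lra.
Qed.

(* Smoothness makes the one-sided derivative of [|.|^2 / 2] linear, so that no
   extension theorem is needed here. *)
Lemma duality_set_nonempty : duality_set x !=set0.
Proof.
have [|f fE] := dual_of_bounded _ dq_norm.
  by move=> a y z; rewrite dq_add dqZ.
exists f; apply: duality_set_of_le; last by rewrite fE; exact: dq_self.
by apply: norm_dual_le => // y; rewrite fE dq_norm.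
Qed.

End directional_derivative.

End smooth_norm.

Lemma cvg_dual_app (R : realType) (E : normedModType R) (I : Type)
    (F : set_system I) {FF : Filter F} (f_ : I -> dual E) (x_ : I -> E)
    (f : dual E) (x : E) :
  f_ @ F --> f -> x_ @ F --> x -> f_ i (x_ i) @[i --> F] --> (f x : R).
Proof.
move=> ff xx.
have fx0 : `|f_ i - f| * `|x_ i| @[i --> F] --> (0 : R).
  rewrite -[X in _ --> X](mul0r `|x|); apply: cvgM; last exact: cvg_norm.
  have : f_ i - f @[i --> F] --> f - f by apply: cvgB => //; exact: cvg_cst.
  by move/cvg_norm; rewrite subrr normr0.
have fxx : f (x_ i) @[i --> F] --> f x.
  by move=> A /dual_continuous/xx.
apply/cvgrPdist_le => /= e e0; have e2 : 0 < e / 2 by rewrite divr_gt0.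
near=> i.
have -> : f x - f_ i (x_ i) = (f x - f (x_ i)) - (f_ i - f) (x_ i).
  by rewrite dualB opprB subrKA.
apply: le_trans (ler_normB _ _) _.
have : `|f x - f (x_ i)| <= e / 2 by near: i; move/cvgrPdist_le: fxx; apply.
have := pair_norm (f_ i - f) (x_ i).
have : `|0 - `|f_ i - f| * `|x_ i| | <= e / 2 by near: i;
  move/cvgrPdist_le: fx0; apply.
rewrite sub0r normrN (@ger0_norm _ (_ * _)) ?mulr_ge0//; lra.
Unshelve. all: by end_near. Qed.

Section duality_map_theory.
Context {R : realType} {E : completeNormedModType R}.
Hypotheses (E_us : uniformly_smooth E) (E_uc : uniformly_convex E).
Implicit Types (x y z p : E) (f g : dual E) (K : set E).

Lemma duality_set_self x f : duality_set x f -> f x = `|x| ^+ 2.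
Proof. by move=> [-> <-]; rewrite expr2. Qed.

Lemma duality_set_subgradient x f z : duality_set x f ->
  `|x| ^+ 2 + 2 * f (z - x) <= `|z| ^+ 2.
Proof.
move=> fx; rewrite pairB (duality_set_self fx); have := pair_le f z.
have := sqr_ge0 (`|x| - `|z|); case: fx => _ <-; lra.
Qed.

Lemma duality_set_dist x x' f g (e d : R) : duality_set x f ->
  duality_set x' g -> 0 < d ->
  (forall y, `|y| <= d ->
    `|x + y| ^+ 2 + `|x - y| ^+ 2 - 2 * `|x| ^+ 2 <= e * `|y|) ->
  0 <= e -> `|x| ^+ 2 - `|x'| ^+ 2 + 2 * g (x' - x) <= e * d ->
  `|g - f| <= e.
Proof.
move=> fx gx d0 dP e0 le; apply: dual_norm_le => y y1.
have half z : `|z| <= 1 -> (g - f) z <= e.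
  move=> z1; rewrite -(ler_pM2l d0) -pairZ dualB.
  have := duality_set_subgradient (x + d *: z) gx.
  have := duality_set_subgradient (x - d *: z) fx.
  have zd : `|d *: z| <= d by rewrite normrZ gtr0_norm// ler_piMr// ltW.
  have := dP _ zd.
  have : e * `|d *: z| <= e * d by rewrite ler_wpM2l.
  by move: le; rewrite !pairB !pairD; lra.
rewrite ler_norml lerNl half// andbT.
by have := half (- y); rewrite linearN normrN; apply.
Qed.

Lemma J_duality x : duality_set x (J x).
Proof. by have [f fx] := duality_set_nonempty E_us x; exact: (getI fx). Qed.

Lemma J_self x : J x x = `|x| ^+ 2.
Proof. exact/duality_set_self/J_duality. Qed.

Lemma norm_J x : `|J x| = `|x|.
Proof. by case: (J_duality x). Qed.

Lemma J_subgradient x z : `|x| ^+ 2 + 2 * J x (z - x) <= `|z| ^+ 2.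
Proof. exact/duality_set_subgradient/J_duality. Qed.

Lemma J_unique x f : duality_set x f -> J x = f.
Proof.
move=> fx; apply/eqP; rewrite -subr_eq0 -normr_le0.
apply/ler_addgt0Pr => e e0; rewrite add0r.
have [d d0 dP] := smooth_sqr_diff E_us x e0.
apply: (duality_set_dist fx (J_duality x) d0 dP (ltW e0)).
by rewrite !subrr linear0 mulr0 addr0 mulr_ge0 ?ltW.
Qed.

Lemma J_continuous : continuous (@J R E).
Proof.
move=> x; apply/cvgrPdist_le => /= e e0.
have [d d0 dP] := smooth_sqr_diff E_us x e0.
pose c := 4 * `|x| + 3.
have c0 : 0 < c by rewrite ltr_wpDl// mulr_ge0.
near=> y; rewrite distrC.
apply: (duality_set_dist (J_duality x) (J_duality y) d0 dP (ltW e0)).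
have xy1 : `|x - y| <= 1 by near: y; apply: cvgr_dist_le => //; exact: cvg_id.
have xyd : `|x - y| <= e * d / c.
  by near: y; apply: cvgr_dist_le; [exact: cvg_id|rewrite divr_gt0 ?mulr_gt0].
apply: (@le_trans _ _ (`|x - y| * c)); last by rewrite -ler_pdivlMr.
have := pair_le (J y) (y - x); rewrite norm_J distrC.
have := lerB_dist x y.
have : `|y| <= `|x| + 1.
  by rewrite -[y](subrK x) addrC (le_trans (ler_normD _ _))// lerD2l distrC.
have := normr_ge0 y; have := normr_ge0 x; have := normr_ge0 (x - y).
rewrite /c; move: `|x - y| `|x| `|y| (J y _) => t a b j.
move=> t0 a0 b0 ba ab jt.
have : t * b <= t * (a + 1) by rewrite ler_wpM2l.
have : (a - b) * (a + b) <= t * (a + b) by rewrite ler_wpM2r// addr_ge0.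
lra.
Unshelve. all: by end_near. Qed.

Lemma cvg_J {I : Type} (F : set_system I) {FF : Filter F} (u : I -> E) x :
  u @ F --> x -> J (u i) @[i --> F] --> J x.
Proof. by move=> ux A /J_continuous/ux. Qed.

Lemma J_surj g : exists x, J x = g.
Proof.
have K0 : [set: E] !=set0 by exists 0.
have cvT : @convex_set R E [set: E] by move=> x y t _ _; rewrite inE.
have [x _ xmin] := convex_min E_uc g K0 closedT cvT.
have {}xmin z : 2 * g (z - x) <= `|z| ^+ 2 - `|x| ^+ 2.
  by have := xmin z I; rewrite /shifted_sqr pairB; lra.
exists x; apply: J_unique; apply: duality_set_of_le.
  apply: norm_dual_le => // y; rewrite -subr_le0.
  apply: (@le0_of_small _ _ (`|y| ^+ 2 / 2)) => t t0 _.
  rewrite -(ler_pM2l t0) mulrBr -pairZ.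
  have := xmin (x + t *: y); rewrite addrAC subrr add0r.
  have : `|x + t *: y| ^+ 2 <= (`|x| + t * `|y|) ^+ 2.
    rewrite ler_pXn2r ?nnegrE ?addr_ge0 ?mulr_ge0 ?(ltW t0)//.
    by apply: le_trans (ler_normD _ _) _; rewrite normrZ gtr0_norm.
  lra.
rewrite -subr_le0; apply: (@le0_of_small _ _ (`|x| ^+ 2 / 2)) => t t0 t1.
rewrite -(ler_pM2l t0).
have := xmin ((1 - t) *: x); rewrite scalerBl scale1r addrAC subrr add0r.
rewrite -scaleNr pairZ -[X in _ <= `|X + _| ^+ 2 - _]scale1r -scalerDl normrZ.
rewrite ger0_norm ?subr_ge0//; lra.
Qed.

Lemma JinvK f : J (Jinv f) = f.
Proof. by have [x xf] := J_surj f; exact: (@getI _ [set x | J x = f] x xf). Qed.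

Lemma norm_Jinv f : `|Jinv f| = `|f|.
Proof. by rewrite -norm_J JinvK. Qed.

Lemma phiE y x : phi y x = shifted_sqr (J x) y + `|x| ^+ 2.
Proof. by []. Qed.

Lemma phi_ge0 y x : 0 <= phi y x.
Proof. by have := J_subgradient x y; rewrite pairB J_self /phi; lra. Qed.

Lemma phixx x : phi x x = 0.
Proof. by rewrite /phi J_self; lra. Qed.

Lemma phi_three_point p x y :
  phi p y = phi p x + phi x y + 2 * (J x - J y) (p - x).
Proof. by rewrite /phi dualB !pairB J_self; lra. Qed.

Lemma phi_sym_sum x y : phi x y + phi y x = 2 * (J x - J y) (x - y).
Proof. by rewrite /phi dualB !pairB !J_self; lra. Qed.

Lemma phi_small (M e : R) : 0 < e -> exists2 d : R, 0 < d &
  forall x y, `|x| <= M -> `|y| <= M -> phi x y < d -> `|x - y| < e.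
Proof.
move=> e0; have [d d0 dP] := uniformly_convex_sqr E_uc M e0.
exists (2 * d) => [|x y xM yM]; first by rewrite mulr_gt0.
rewrite (ltNge _ e); apply: contraTN => exy; rewrite -leNgt.
have := dP x y xM yM exy; have := J_subgradient y (2^-1 *: (x + y)).
rewrite pairB pairZ pairD J_self /phi; lra.
Qed.

Lemma phi_eq0 x y : phi x y = 0 -> x = y.
Proof.
move=> xy0; apply/eqP; rewrite -subr_eq0 -normr_le0.
apply/ler_addgt0Pr => e e0; rewrite add0r.
have [d d0 dP] := phi_small (Num.max `|x| `|y|) e0.
by apply/ltW/dP; rewrite ?le_max ?lexx ?orbT ?xy0.
Qed.

Lemma J_strictly_monotone x y : (J x - J y) (x - y) <= 0 -> x = y.
Proof.
move=> xy; apply: phi_eq0; apply/eqP; rewrite eq_le phi_ge0 andbT.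
by have := phi_sym_sum x y; have := phi_ge0 y x; lra.
Qed.

Lemma J_inj : injective (@J R E).
Proof.
by move=> x y xy; apply: J_strictly_monotone; rewrite xy subrr.
Qed.

Lemma JK x : Jinv (J x) = x.
Proof. by apply: J_inj; rewrite JinvK. Qed.

Lemma norm_le_phi y x : `|y| <= `|x| + Num.sqrt (phi y x).
Proof.
rewrite addrC -lerBlDr; have [le0|gt0] := leP (`|y| - `|x|) 0.
  exact: le_trans le0 (sqrtr_ge0 _).
rewrite -(ger0_norm (ltW gt0)) -sqrtr_sqr ler_wsqrtr//.
have := pair_le (J x) y; rewrite norm_J /phi; lra.
Qed.

Lemma norm_le_phi_r y x : `|x| <= `|y| + Num.sqrt (phi y x).
Proof.
rewrite addrC -lerBlDr; have [le0|gt0] := leP (`|x| - `|y|) 0.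
  exact: le_trans le0 (sqrtr_ge0 _).
rewrite -(ger0_norm (ltW gt0)) -sqrtr_sqr ler_wsqrtr//.
have := pair_le (J x) y; rewrite norm_J /phi; lra.
Qed.

Lemma Jinv_continuous : continuous (@Jinv R E).
Proof.
move=> f; have FF : Filter (nbhs f) by exact: nbhs_filter.
apply/cvgrPdist_lt => e e0.
pose M := `|f| + 1.
have [d d0 dP] := phi_small M e0.
have M0 : 0 < 4 * M by rewrite mulr_gt0// ltr_wpDl.
near=> g.
have fg1 : `|f - g| <= 1 by near: g; apply: cvgr_dist_le => //; exact: cvg_id.
have fgd : `|f - g| < d / (4 * M).
  by near: g; apply: cvgr_dist_lt; [exact: cvg_id|rewrite divr_gt0].
have fM : `|f| <= M by rewrite /M lerDl.
have gM : `|g| <= M.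
  by rewrite -[g](subrK f) addrC (le_trans (ler_normD _ _))// lerD2l distrC.
apply: dP; rewrite ?norm_Jinv//.
have := phi_ge0 (Jinv g) (Jinv f); have := phi_sym_sum (Jinv f) (Jinv g).
have := pair_le (f - g) (Jinv f - Jinv g); rewrite !JinvK.
have : `|Jinv f - Jinv g| <= 2 * M.
  by have := ler_normB (Jinv f) (Jinv g); rewrite !norm_Jinv; lra.
move=> /(ler_wpM2l (normr_ge0 (f - g))).
by move: fgd; rewrite ltr_pdivlMr//; lra.
Unshelve. all: by end_near. Qed.

Lemma gen_proj_exists K x : K !=set0 -> closed K -> @convex_set R E K ->
  exists p, [/\ K p, forall y, K y -> phi p x <= phi y x & gen_proj K x = [set
    p]].
Proof.
move=> K0 cK vK; have [p Kp pmin] := convex_min E_uc (J x) K0 cK vK.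
have {}pmin y : K y -> phi p x <= phi y x.
  by move=> Ky; rewrite !phiE lerD2r pmin.
have infE : inf [set phi y x | y in K] = phi p x.
  apply/eqP; rewrite eq_le ge_inf ?lb_le_inf//.
  - by exists (phi p x), p.
  - by move=> _ [y Ky <-]; exact: pmin.
  - by exists 0 => _ [y _ <-]; exact: phi_ge0.
  - by exists p.
exists p; split => //; rewrite /gen_proj infE.
apply/seteqP; split => [q [/= Kq qp]|_ ->//].
apply/eqP; rewrite -subr_eq0 -normr_le0; apply/ler_addgt0Pr => e e0.
rewrite add0r leNgt; apply/negP => /ltW eqp.
have [c c0 uc] := uniformly_convex_sqr E_uc (Num.max `|p| `|q|) e0.
have := uc q p; rewrite !le_max !lexx orbT => /(_ isT isT eqp).
have : K (2^-1 *: (q + p)).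
  have := convex_setE vK Kq Kp (t := 2^-1).
  by rewrite scalerDr (_ : 1 - 2^-1 = 2^-1 :> R); [apply; lra|lra].
move/pmin; move: qp; rewrite /phi pairZ pairD; lra.
Qed.

Lemma gen_proj_ineq K x p y : @convex_set R E K -> K p ->
  (forall z, K z -> phi p x <= phi z x) -> K y ->
  phi y p + phi p x <= phi y x.
Proof.
move=> vK Kp pmin Ky.
rewrite (phi_three_point y p x) lerDl pmulr_rge0//.
pose u (t : R) := t *: y + (1 - t) *: p.
have uE t : u t = p + t *: (y - p).
  by rewrite /u scalerBl scale1r scalerBr addrCA addrA.
have ineq (t : R) : 0 < t -> t <= 1 -> 0 <= (J (u t) - J x) (y - p).
  move=> t0 t1; have Ku : K (u t) by apply: convex_setE => //; rewrite ltW.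
  have := pmin _ Ku; rewrite (phi_three_point p (u t) x).
  have -> : p - u t = - t *: (y - p).
    by rewrite uE opprD addrA subrr sub0r scaleNr.
  have := phi_ge0 p (u t); rewrite pairZ.
  move=> a b; have : 0 <= t * (J (u t) - J x) (y - p) by lra.
  by rewrite pmulr_rge0.
have u0 : u t @[t --> 0^'+] --> p by exact: cvg_segment.
have Ju : J (u t) @[t --> 0^'+] --> J p.
  exact: cvg_J.
have cvg : (J (u t) - J x) (y - p) @[t --> 0^'+] --> (J p - J x) (y - p).
  apply: cvg_dual_app; last exact: cvg_cst.
  by apply: cvgB => //; exact: cvg_cst.
apply: (@closed_cvg _ _ (0^'+) _ (fun t => (J (u t) - J x) (y - p))
  [set r : R | 0 <= r] (@closed_ge _ _) _ _ cvg).
near=> t; apply: ineq; first by near: t; exact: nbhs_right_gt.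
by near: t; apply: nbhs_right_le.
Unshelve. all: by end_near. Qed.

End duality_map_theory.

(** * Monotone variational inequalities *)

(* Minimize over the simplex the sum of the squared negative parts of
   [\sum_j M i j * l j]; at a minimizer, weighting the optimality conditions by
   the negative parts themselves contradicts the hypothesis on M. *)
Lemma skew_game (R : realType) n (M : 'I_n.+1 -> 'I_n.+1 -> R) :
  (forall i j, 0 <= M i j + M j i) ->
  exists l : 'I_n.+1 -> R, [/\ forall i, 0 <= l i, \sum_i l i = 1 &
    forall i, 0 <= \sum_j M i j * l j].
Proof.
move=> M_ge0.
pose Ml (v : 'rV[R]_n.+1) i := \sum_j M i j * v ord0 j.
pose p (x : R) := x + `|x|.
pose F v := \sum_i (p (- Ml v i)) ^+ 2.
pose A := [set v : 'rV[R]_n.+1 | (forall i, v ord0 i \in `[0, 1]) /\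
  \sum_i v ord0 i = 1].
have ccoord i : continuous (fun v : 'rV[R]_n.+1 => v ord0 i).
  exact: coord_continuous.
have sum_cont (g : 'I_n.+1 -> 'rV[R]_n.+1 -> R) :
    (forall i, continuous (g i)) -> continuous (fun v => \sum_i g i v).
  have addc : continuous (fun z : R * R => z.1 + z.2).
    by move=> z; apply: cvgD; [exact: cvg_fst|exact: cvg_snd].
  by move=> gc; apply: (continuous_big addc) => i _; exact: gc.
have A_cpt : compact A.
  have cube := @rV_compact R n.+1 (fun=> `[0, 1]%classic) (fun=>
    @segment_compact R 0 1).
  apply: (subclosed_compact _ cube); last by move=> v [v01 _] i; exact: v01.
  have -> : A = [set v : 'rV[R]_n.+1 | forall i, v ord0 i \in `[0, 1]] `&`
     (fun v : 'rV[R]_n.+1 => \sum_i v ord0 i) @^-1` [set 1] by [].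
  apply: closedI.
    exact: compact_closed.
  apply: preimage_closed; last exact: closed_eq.
  by move=> v _; apply: (sum_cont _) => i; exact: ccoord.
have A0 : A !=set0.
  exists (delta_mx ord0 ord0); split => [i|].
    by rewrite mxE in_itv/= ler0n lern1 leq_b1.
  rewrite (bigD1 ord0)//= mxE !eqxx big1 ?addr0// => i i0.
  by rewrite mxE eqxx (negbTE i0).
have F_cont : continuous F.
  apply: (sum_cont _) => i v.
  have Mlc : continuous (fun w => Ml w i).
    apply: (sum_cont (fun j w => M i j * w ord0 j)) => j u.
    have FF : Filter (nbhs u) by exact: nbhs_filter.
    by apply: cvgMr; exact: ccoord.
  have FF : Filter (nbhs v) by exact: nbhs_filter.
  have {}Mlc : - Ml w i @[w --> v] --> - Ml v i by exact: (@cvgN _ R^o _ _ _ _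
    _ (Mlc v)).
  have nMlc : `|- Ml w i| @[w --> v] --> `|- Ml v i| by exact: cvg_norm Mlc.
  have pc : p (- Ml w i) @[w --> v] --> p (- Ml v i).
    exact: (@cvgD _ R^o _ _ _ _ _ _ _ Mlc nMlc).
  exact: (cvgM pc pc).
have [w wA wmin] := EVT_min_rV A0 A_cpt (continuous_subspaceT F_cont).
move: wA; rewrite inE => -[w01 w1].
pose mu i := p (- Ml w i).
have mu0 i : 0 <= mu i by rewrite /mu /p; have := ler_norm (Ml w i);
  rewrite normrN; lra.
have muM i : mu i * Ml w i = - (mu i ^+ 2) / 2.
  rewrite /mu /p normrN; case: (ler0P (Ml w i)) => _; lra.
have opt j : \sum_i mu i * M i j <= - (\sum_i mu i ^+ 2) / 2.
  pose c i := M i j - Ml w i.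
  suff muc : \sum_i mu i * c i <= 0.
    rewrite -subr_le0 -mulrN1 mulrAC mulrN1 opprK mulr_suml -big_split/=.
    apply: le_trans muc; apply: ler_sum => i _.
    by rewrite /c mulrBr muM; lra.
  apply: (@le0_of_small _ _ (\sum_i c i ^+ 2)) => t t0 t1.
  pose wt := (1 - t) *: w + t *: delta_mx ord0 j.
  have wtE i : wt ord0 i = (1 - t) * w ord0 i + t * (i == j)%:R.
    by rewrite !mxE eqxx.
  have wtA : wt \in A.
    rewrite inE; split => [i|].
      have := w01 i; rewrite !in_itv/= wtE => /andP[wi0 wi1].
      have : 0 <= (1 - t) * w ord0 i by rewrite mulr_ge0// subr_ge0.
      have : (1 - t) * w ord0 i <= 1 - t by rewrite ler_piMr// subr_ge0.
      by case: (i == j); rewrite ?mulr1 ?mulr0 => *; apply/andP; split; lra.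
    under eq_bigr do rewrite wtE.
    rewrite big_split/= -mulr_sumr w1 -mulr_sumr (bigD1 j)//= eqxx big1 ?addr0.
      by rewrite !mulr1 subrK.
    by move=> i /negbTE ->.
  have MlE i : - Ml wt i = - Ml w i - t * c i.
    rewrite /Ml; under eq_bigr do rewrite wtE mulrDr.
    rewrite big_split/= [X in - (_ + X)](bigD1 j)//= eqxx [X in - (_ + (_ +
      X))]big1.
      under eq_bigr do rewrite mulrCA.
      by rewrite -mulr_sumr /c -/(Ml w i) mulr1 addr0; ring.
    by move=> k /negbTE ->; rewrite !mulr0.
  have := wmin wt wtA.
  have : F wt <= \sum_i (mu i - 2 * t * c i) ^+ 2.
    apply: ler_sum => i _; rewrite MlE.
    have : 2 * (- Ml w i) <= mu i by rewrite /mu /p;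
      have := ler_norm (- Ml w i); lra.
    rewrite /p; case: (ler0P (- Ml w i - t * c i)) => h ham.
      by rewrite subrr expr0n/= sqr_ge0.
    by rewrite ler_pXn2r ?nnegrE//; lra.
  have -> : \sum_i (mu i - 2 * t * c i) ^+ 2 =
      F w - 4 * t * (\sum_i mu i * c i) + 4 * t ^+ 2 * \sum_i c i ^+ 2.
    rewrite /F !mulr_sumr -sumrB -big_split/=; apply: eq_bigr => i _.
    by rewrite /mu; ring.
  move=> h1 h2; rewrite -(ler_pM2l t0); nra.
pose Smu := \sum_i mu i; pose Sq := \sum_i mu i ^+ 2.
have Sq0 i : mu i ^+ 2 <= Sq.
  by rewrite /Sq (bigD1 i)//= lerDl sumr_ge0// => j _; exact: sqr_ge0.
have Smu0 i : mu i <= Smu by rewrite /Smu (bigD1 i)//= lerDl sumr_ge0.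
have le : \sum_j mu j * (\sum_i mu i * M i j) <= Smu * (- Sq / 2).
  rewrite /Smu mulr_suml; apply: ler_sum => j _.
  by rewrite ler_wpM2l// opt.
have ge : 0 <= \sum_j mu j * (\sum_i mu i * M i j).
  have dbl : 0 <= \sum_j \sum_i mu j * mu i * (M i j + M j i).
    by do 2![apply: sumr_ge0 => ? _]; rewrite !mulr_ge0.
  have E1 : \sum_j mu j * (\sum_i mu i * M i j) = \sum_j \sum_i mu j * mu i * M
    i j.
    by apply: eq_bigr => j _; rewrite mulr_sumr; apply: eq_bigr => i _;
      rewrite mulrA.
  have E2 : \sum_j mu j * (\sum_i mu i * M i j) = \sum_j \sum_i mu j * mu i * M
    j i.
    rewrite E1 exchange_big/=; apply: eq_bigr => j _; apply: eq_bigr => i _.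
    by rewrite (mulrC (mu i)).
  have : \sum_j \sum_i mu j * mu i * (M i j + M j i) =
     \sum_j \sum_i mu j * mu i * M i j + \sum_j \sum_i mu j * mu i * M j i.
    rewrite -big_split; apply: eq_bigr => j _; rewrite -big_split.
    by apply: eq_bigr => i _; rewrite mulrDr.
  by rewrite -E1 -E2; lra.
exists (fun i => w ord0 i); split => // i; first by have := w01 i;
  rewrite in_itv => /andP[].
rewrite leNgt; apply/negP => Mneg.
have mui : 0 < mu i.
  by rewrite /mu /p; have := ler_norm (- Ml w i); rewrite /Ml; lra.
have Smu_gt0 : 0 < Smu by exact: lt_le_trans mui (Smu0 i).
have Sq_gt0 : 0 < Sq by apply: lt_le_trans (Sq0 i); rewrite exprn_gt0.
have := mulr_gt0 Smu_gt0 Sq_gt0; lra.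
Qed.

Section finite_convexity.
Context {R : realType} {E : normedModType R}.

Lemma convex_set_sum (C : set E) n (l : nat -> R) (y : nat -> E) :
  @convex_set R E C -> (forall i, 0 <= l i) -> (forall i, C (y i)) ->
  \sum_(i < n) l i = 1 -> C (\sum_(i < n) l i *: y i).
Proof.
move=> vC l0 Cy l1.
suff H : 0 < \sum_(i < n) l i ->
    C ((\sum_(i < n) l i)^-1 *: \sum_(i < n) l i *: y i).
  by move: H; rewrite l1 invr1 scale1r; apply.
elim: n {l1} => [|n IH]; first by rewrite big_ord0 ltxx.
rewrite !big_ord_recr/=; set S := \sum_(i < n) l i.
have S0 : 0 <= S by apply: sumr_ge0.
have [Sz|Sn] := eqVneq S 0.
  rewrite Sz add0r big1 ?add0r => [ln0|i _].
    by rewrite scalerA mulVf ?scale1r// gt_eqF.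
  move/eqP: Sz; rewrite psumr_eq0// => /allP/(_ i).
  by rewrite mem_index_enum => /(_ isT)/eqP ->; rewrite scale0r.
have Sgt0 : 0 < S by rewrite lt_def Sn.
move=> Sl; rewrite (_ : (S + l n)^-1 *: _ =
  (S / (S + l n)) *: (S^-1 *: \sum_(i < n) l i *: y i) +
  (1 - S / (S + l n)) *: y n); last first.
  rewrite scalerA mulrAC mulfV// mul1r scalerDr scalerA; congr (_ + _ *: _).
  by field; rewrite gt_eqF.
apply: convex_setE => //; first exact: IH.
by rewrite divr_ge0 ?(ltW Sl)//= ler_pdivrMr// mul1r lerDl.
Qed.

Lemma norm_sum_sqr n (l : 'I_n -> R) (y : 'I_n -> E) :
  (forall i, 0 <= l i) -> \sum_i l i = 1 ->
  `|\sum_i l i *: y i| ^+ 2 <= \sum_i l i * `|y i| ^+ 2.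
Proof.
move=> l0 l1; pose m := \sum_i l i * `|y i|.
apply: (@le_trans _ _ (m ^+ 2)).
  have m0 : 0 <= m by apply: sumr_ge0 => i _; rewrite mulr_ge0.
  rewrite ler_pXn2r ?nnegrE//; apply: le_trans (ler_norm_sum _ _ _) _.
  by apply: ler_sum => i _; rewrite normrZ ger0_norm.
have mE : \sum_i l i * `|y i| = m by [].
clearbody m; rewrite -subr_ge0.
have -> : \sum_i l i * `|y i| ^+ 2 - m ^+ 2 = \sum_i l i * (`|y i| - m) ^+ 2.
  have -> : \sum_i l i * (`|y i| - m) ^+ 2 =
     \sum_i l i * `|y i| ^+ 2 - 2 * m * (\sum_i l i * `|y i|)
     + m ^+ 2 * \sum_i l i.
    rewrite !mulr_sumr -sumrB -big_split/=; apply: eq_bigr => i _; ring.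
  by rewrite l1 mE; ring.
by apply: sumr_ge0 => i _; rewrite mulr_ge0 ?sqr_ge0.
Qed.

End finite_convexity.

Lemma cvg_within_continuous (R : realType) (E V : normedModType R) (C : set E)
    (A : E -> V) (I : Type) (F : set_system I) {FF : Filter F} (u : I -> E) x :
  {within C, continuous A} -> C x -> (\forall i \near F, C (u i)) ->
  u @ F --> x -> A (u i) @[i --> F] --> A x.
Proof.
move=> AC Cx Cu ux B AB.
have /AC := AB; rewrite /nbhs/= -nbhs_subspace_in// => WB.
have {WB} := ux _ WB; rewrite /= => WB.
by apply: filterS2 Cu WB => i Ci; apply.
Qed.

Section variational_inequality.
Context {R : realType} {E : completeNormedModType R}.
Hypotheses (E_us : uniformly_smooth E) (E_uc : uniformly_convex E).
Variables (C : set E) (A : E -> dual E).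
Hypotheses (C0 : C !=set0) (C_closed : closed C) (C_convex : @convex_set R E C).
Hypotheses (A_cont : {within C, continuous A}) (A_mono : monotone_on C A).
Implicit Types (x y z p s : E) (r : R).

Lemma VI_resolvent_unique r s z1 z2 : 0 < r ->
  VI_resolvent C A r s z1 -> VI_resolvent C A r s z2 -> z1 = z2.
Proof.
move=> r0 [C1 H1] [C2 H2]; apply: (J_strictly_monotone E_us E_uc).
have := H1 _ C2; have := H2 _ C1; have := A_mono C1 C2.
rewrite !dualB !pairB => h1 h2 h3.
have : 0 <= r^-1 * ((J z2 z1 - J z2 z2) - (J z1 z1 - J z1 z2)) by lra.
rewrite pmulr_rge0 ?invr_gt0//; lra.
Qed.

Lemma VI_resolvent_phi r s z p : 0 < r ->
  VI_resolvent C A r s z -> VI C A p -> phi p z + phi z s <= phi p s.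
Proof.
move=> r0 [Cz Hz] [Cp Hp];
  rewrite (phi_three_point E_us p z s) lerDl pmulr_rge0//.
have := Hz _ Cp; have := Hp _ Cz; have := A_mono Cz Cp.
rewrite !dualB !pairB => h1 h2 h3.
have : 0 <= r^-1 * (J z p - J z z - (J s p - J s z)) by lra.
by rewrite pmulr_rge0 ?invr_gt0//; lra.
Qed.

(* [g y = J s - r (A y)] turns the Minty form of the inequality into
   [shifted_sqr (g y) z <= shifted_sqr (g y) y], so that the solutions form an
   intersection of bounded closed convex sets. *)
Let g r s y : dual E := J s - r *: A y.

Let sublevel r s y : set E :=
  [set z | shifted_sqr (g r s y) z <= shifted_sqr (g r s y) y].

Let shifted_sqr_conv f x y (t : R) : 0 <= t <= 1 ->
  shifted_sqr f (t *: x + (1 - t) *: y) <=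
  t * shifted_sqr f x + (1 - t) * shifted_sqr f y.
Proof.
move=> t01; have := norm_conv_sqr x y t01.
by rewrite /shifted_sqr pairD !pairZ; lra.
Qed.

Let sublevels_meet r s y0 (ys : seq E) : 0 < r -> C y0 ->
  (forall y, y \in ys -> C y) ->
  exists2 z, C z & forall y, y \in y0 :: ys -> sublevel r s y z.
Proof.
move=> r0 Cy0 Cys; pose Y i := nth y0 (y0 :: ys) i.
have CY i : C (Y i).
  have [iy|iy] := ltnP i (size (y0 :: ys)); last by rewrite /Y nth_default.
  by have := mem_nth y0 iy; rewrite -/(Y i) inE => /orP[/eqP->//|/Cys].
pose M (i j : 'I_(size ys).+1) : R :=
  shifted_sqr (g r s (Y i)) (Y i) - shifted_sqr (g r s (Y i)) (Y j).
have [|l [l0 l1 lM]] := @skew_game _ _ M.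
  move=> i j; rewrite /M /shifted_sqr /g !dualB !dualZ.
  have := A_mono (CY i) (CY j); rewrite -(pmulr_rge0 _ r0) dualB !pairB; lra.
exists (\sum_(i < (size ys).+1) l i *: Y i).
  have := @convex_set_sum _ _ C (size ys).+1 (fun i => l (inord i)) Y C_convex.
  under [X in X = 1 -> _]eq_bigr do rewrite inord_val.
  under [X in C X]eq_bigr do rewrite inord_val.
  by apply.
move=> y yin; pose i : 'I_(size ys).+1 := inord (index y (y0 :: ys)).
have yE : y = Y i.
  by rewrite /Y /i inordK ?nth_index// -[X in (_ < X)%N]/(size (y0 :: ys))
    index_mem.
have := lM i; rewrite /sublevel/=.
have := norm_sum_sqr (fun i : 'I_(size ys).+1 => Y i) l0 l1.
set f := g r s y; set z := \sum_(_ < _) _ => zle Mi.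
have fz : f z = \sum_i l i * f (Y i).
  by rewrite linear_sum; apply: eq_bigr => k _; exact: pairZ.
have ME : \sum_j M i j * l j = shifted_sqr f y - \sum_j l j * shifted_sqr f (Y
  j).
  rewrite -[X in X - _]mulr1 -l1 mulr_sumr -sumrB; apply: eq_bigr => j _.
  by rewrite /M -yE -/f; ring.
have SE : \sum_j l j * shifted_sqr f (Y j) =
    \sum_j l j * `|Y j| ^+ 2 - 2 * f z.
  rewrite fz mulr_sumr -sumrB; apply: eq_bigr => j _.
  by rewrite /shifted_sqr; ring.
rewrite (_ : shifted_sqr f z = `|z| ^+ 2 - 2 * f z)//.
by move: Mi; rewrite ME SE; lra.
Qed.

Lemma Minty r s z : 0 < r -> C z -> (forall y, C y -> sublevel r s y z) ->
  VI_resolvent C A r s z.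
Proof.
move=> r0 Cz zmin; split => // y Cy.
pose u (t : R) := t *: y + (1 - t) *: z.
have uE t : u t = z + t *: (y - z).
  by rewrite /u scalerBl scale1r scalerBr addrCA addrA.
have Cu t : 0 < t -> t <= 1 -> C (u t).
  by move=> t0 t1; apply: convex_setE => //; rewrite (ltW t0).
have ineq t : 0 < t -> t <= 1 ->
    0 <= r * A (u t) (y - z) + (J (u t) - J s) (y - z).
  move=> t0 t1; have := zmin _ (Cu t t0 t1); rewrite /sublevel/=.
  have := J_subgradient E_us (u t) z.
  have -> : z - u t = - t *: (y - z).
    by rewrite uE opprD addrA subrr sub0r scaleNr.
  have fu (f : dual E) : f (u t) = f z + t * f (y - z).
    by rewrite uE [LHS]pairD pairZ.
  rewrite /shifted_sqr fu pairZ !dualB !dualZ => h1 h2.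
  suff : 0 <= t * (r * A (u t) (y - z) + (J (u t) (y - z) - J s (y - z))).
    by rewrite pmulr_rge0.
  lra.
have uz : u t @[t --> 0^'+] --> z by exact: cvg_segment.
have uC : \forall t \near (0 : R)^'+, C (u t).
  near=> t; apply: Cu; near: t; first exact: nbhs_right_gt.
  exact: nbhs_right_le.
have lim : r * A (u t) (y - z) + (J (u t) - J s) (y - z) @[t --> 0^'+] -->
    r * A z (y - z) + (J z - J s) (y - z).
  apply: cvgD.
    apply: cvgMr; apply: cvg_dual_app; last exact: cvg_cst.
    exact: cvg_within_continuous.
  apply: cvg_dual_app; last exact: cvg_cst.
  by apply: cvgB; [exact: cvg_J|exact: cvg_cst].
have : 0 <= r * A z (y - z) + (J z - J s) (y - z).
  apply: (@closed_cvg _ _ (0^'+) _ (fun t => r * A (u t) (y - z) +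
    (J (u t) - J s) (y - z)) [set r : R | 0 <= r] (@closed_ge _ _) _ _ lim).
  near=> t; apply: ineq; near: t; first exact: nbhs_right_gt.
  exact: nbhs_right_le.
move=> lim_ge0; rewrite -(pmulr_rge0 _ r0).
by rewrite mulrDr mulVKf ?gt_eqF.
Unshelve. all: by end_near. Qed.

Lemma VI_resolvent_exists r s : 0 < r ->
  exists z, VI_resolvent C A r s = [set z].
Proof.
move=> r0; have [y0 Cy0] := C0.
pose K (ys : seq E) := [set z | C z /\ forall y, y \in ys -> sublevel r s y z].
pose D := [set K ys | ys in [set ys : seq E | forall y, y \in ys -> C y]].
have cl_sub y : closed (sublevel r s y).
  apply: (@preimage_closed _ _ (shifted_sqr (g r s y))
    [set a : R | a <= shifted_sqr (g r s y) y]); last exact: closed_le.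
  by move=> z _; exact: continuous_shifted_sqr.
have [|K' [ys Cys <-]|K' [ys Cys <-]|K1 K2 [ys1 C1 <-] [ys2 C2 <-]|K' [ys Cys
  <-]|] :=
  @convex_family_min _ _ E_uc D (g r s y0) (shifted_sqr (g r s y0) y0).
- by exists (K [::]), [::].
- have -> : K ys = C `&` \bigcap_(y in [set y | y \in ys]) sublevel r s y by [].
  by apply: closedI => //; apply: closed_bigI => y _; exact: cl_sub.
- move=> x y t; rewrite !inE => -[Cx Hx] [Cy Hy].
  have t01 : 0 <= t%:num <= 1 by rewrite ge0 le1.
  split; first exact: (convex_setE C_convex Cx Cy t01).
  move=> w wys; rewrite /sublevel/=.
  apply: le_trans (shifted_sqr_conv _ x y t01) _.
  have := Hx w wys; have := Hy w wys; rewrite /sublevel/=.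
  move: (shifted_sqr _ x) (shifted_sqr _ y) (shifted_sqr _ w) => a b c bc ac.
  move/andP: t01 => [t0]; rewrite -subr_ge0 => t1.
  by have := ler_wpM2l t0 ac; have := ler_wpM2l t1 bc; lra.
- exists (K (ys1 ++ ys2)).
    by exists (ys1 ++ ys2) => // y; rewrite mem_cat => /orP[/C1|/C2].
  move=> z [Cz Hz]; split; split => // y yin; apply: Hz; rewrite mem_cat yin//.
  by rewrite orbT.
- have [z Cz Hz] := sublevels_meet s r0 Cy0 Cys.
  exists z; last by apply: Hz; rewrite inE eqxx.
  by split => // y yin; apply: Hz; rewrite inE yin orbT.
move=> d [z [DK _ _]]; exists z.
have Cz : C z by have [] := DK (K [::]); first by exists [::].
have zV : VI_resolvent C A r s z.
  apply: Minty => // y Cy; have [|_] := DK (K [:: y]).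
    by exists [:: y] => // y'; rewrite inE => /eqP ->.
  by apply; rewrite inE.
apply/seteqP; split => [z' z'V|_ -> //].
exact: VI_resolvent_unique z'V zV.
Qed.

End variational_inequality.

(** * Equilibrium problems *)

Section equilibrium.
Context {R : realType} {E : completeNormedModType R}.
Hypotheses (E_us : uniformly_smooth E) (E_uc : uniformly_convex E).
Variables (C : set E) (f : dual E -> dual E -> R).
Hypotheses (JC_convex : @convex_set R (dual E) (J @` C)).
Hypothesis f_eq : eq_bifunction (J @` C) f.
Implicit Types (x y z p s : E) (r : R).

Let f_mono x y : C x -> C y -> f (J x) (J y) + f (J y) (J x) <= 0.
Proof. by move=> Cx Cy; case: f_eq => _ mono _ _; apply: mono;
  [exists x|exists y]. Qed.

Lemma EP_resolvent_unique r s z1 z2 : 0 < r ->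
  EP_resolvent C f r s z1 -> EP_resolvent C f r s z2 -> z1 = z2.
Proof.
move=> r0 [C1 H1] [C2 H2]; apply: (J_strictly_monotone E_us E_uc).
have := H1 _ C2; have := H2 _ C1; have := f_mono C1 C2.
rewrite !dualB !pairB => h1 h2 h3.
have : 0 <= r^-1 * ((J z2 z1 - J z2 z2) - (J z1 z1 - J z1 z2)) by lra.
rewrite pmulr_rge0 ?invr_gt0//; lra.
Qed.

Lemma EP_resolvent_phi r s z p : 0 < r ->
  EP_resolvent C f r s z -> EP C f p -> phi p z + phi z s <= phi p s.
Proof.
move=> r0 [Cz Hz] [Cp Hp];
  rewrite (phi_three_point E_us p z s) lerDl pmulr_rge0//.
have := Hz _ Cp; have := Hp _ Cz; have := f_mono Cz Cp.
rewrite !dualB !pairB => h1 h2 h3.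
have : 0 <= r^-1 * (J z p - J z z - (J s p - J s z)) by lra.
by rewrite pmulr_rge0 ?invr_gt0//; lra.
Qed.

Lemma EP_limit (I : Type) (F : set_system I) {FF : ProperFilter F} (z : I -> E)
    (c : E -> I -> R) z0 : C z0 ->
  (\forall n \near F, C (z n) /\
    forall y, C y -> 0 <= f (J (z n)) (J y) + c y n) ->
  z @ F --> z0 -> (forall y, C y -> c y @ F --> (0 : R)) -> EP C f z0.
Proof.
move=> Cz0 Cz zz0 c0; case: f_eq => f0 fmono f_hemi f_cvx.
have f_le0 y : C y -> f (J y) (J z0) <= 0.
  move=> Cy; rewrite leNgt; apply/negP => f_gt0.
  pose a := f (J y) (J z0) / 2; have a0 : 0 < a by rewrite divr_gt0.
  have Ky : (J @` C) (J y) by exists y.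
  have [|V V0 aV] := (f_cvx _ Ky).2 (J z0) a; first by rewrite lte_fin /a; lra.
  have {V0} : within (J @` C) (nbhs (J z0)) V.
    by rewrite nbhs_subspace_in//; exists z0.
  move=> /(cvg_J E_us zz0) zV.
  have ca : \forall n \near F, `|0 - c y n| < a.
    by have /cvgrPdist_lt := c0 y Cy; apply.
  suff : \forall n \near F, False by move/filter_ex => [].
  apply: filterS3 Cz zV ca => n [Czn Hn] zVn can.
  have /aV : V (J (z n)) by apply: zVn; exists (z n).
  rewrite lte_fin; have := Hn y Cy; have := f_mono Cy Czn.
  by move: can; rewrite sub0r normrN; have := ler_norm (c y n); lra.
split=> // y Cy.
have Ky : (J @` C) (J y) by exists y.
have Kz0 : (J @` C) (J z0) by exists z0.
pose u (t : R) : dual E := t *: J y + (1 - t) *: J z0.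
have u_ge0 t : 0 < t -> t <= 1 -> 0 <= f (u t) (J y).
  move=> t0 t1.
  have [x Cx xu] : (J @` C) (u t).
    by apply: (convex_setE JC_convex Ky Kz0); rewrite (ltW t0).
  have it : Itv.spec (@Itv.num_sem R) (Itv.Real `[0%Z, 1%Z]) t.
    by rewrite /= /Itv.num_sem /= realE in_itv/= (ltW t0) t1.
  have Ku : (J @` C) (u t) by exists x.
  have := (f_cvx _ Ku).1 (Itv.mk it) (J y) (J z0).
  rewrite !inE => /(_ Ky Kz0).
  have := f0 _ Ku; have := f_le0 x Cx; rewrite xu => h0 fu.
  have -> : f (u t) (conv (Itv.mk it) (J y : convex_lmodType (dual E)) (J z0))
    = f (u t) (u t) by [].
  rewrite fu => h1.
  have {}h1 : 0 <= t * f (u t) (J y) + (1 - t) * f (u t) (J z0) by exact: h1.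
  have : 0 <= t * f (u t) (J y).
    have : (1 - t) * f (u t) (J z0) <= 0 by rewrite mulr_ge0_le0// subr_ge0.
    by lra.
  by rewrite pmulr_rge0.
rewrite -lee_fin; apply: le_trans (f_hemi _ _ _ Kz0 Ky Ky).
rewrite limf_esupE; apply: le_ereal_inf_tmp => _ [V V0 <-].
have [t [Vt t0 t1]] : exists t, [/\ V t, 0 < t & t <= 1].
  have V1 : \forall t \near (0 : R)^'+, [/\ V t, 0 < t & t <= 1].
    near=> t; split; near: t => //; [exact: nbhs_right_gt|exact: nbhs_right_le].
  exact: filter_ex V1.
apply: (@le_trans _ _ (f (u t) (J y))%:E); first by rewrite lee_fin u_ge0.
by apply: ereal_sup_ubound; exists t.
Unshelve. all: by end_near. Qed.

End equilibrium.

Section phi_convergence.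
Context {R : realType} {E : completeNormedModType R}.
Hypotheses (E_us : uniformly_smooth E) (E_uc : uniformly_convex E).
Context {I : Type} {F : set_system I} {FF : Filter F}.
Implicit Types (a b : I -> E) (x y p : E).

Lemma cvg_phi a b x y : a @ F --> x -> b @ F --> y ->
  phi (a i) (b i) @[i --> F] --> phi x y.
Proof.
move=> ax bY.
have sq (c : I -> E) (v : E) : c @ F --> v -> `|c i| ^+ 2 @[i --> F] --> `|v|
  ^+ 2.
  by move=> /cvg_norm cv; exact: (cvgM cv cv).
apply: cvgD; last exact: sq.
apply: cvgB; first exact: sq.
by apply: cvgMr; apply: cvg_dual_app => //; exact: cvg_J.
Qed.

Lemma cvg_Jinv (g : I -> dual E) (f : dual E) : g @ F --> f ->
  Jinv (g i) @[i --> F] --> Jinv f.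
Proof. by move=> gf A /(Jinv_continuous E_us E_uc)/gf. Qed.

Lemma phi_cvg0_dist a b (M : R) : (\forall i \near F, `|a i| <= M /\ `|b i| <=
  M) ->
  phi (a i) (b i) @[i --> F] --> (0 : R) -> a i - b i @[i --> F] --> (0 : E).
Proof.
move=> abM /cvgrPdist_lt ab0; apply/cvgrPdist_lt => /= e e0.
have [d d0 dP] := phi_small E_us E_uc M e0.
apply: filterS2 abM (ab0 d d0) => i [aM bM]; rewrite !sub0r !normrN => abd.
by apply: dP => //; exact: le_lt_trans (ler_norm _) abd.
Qed.

Let near_bound a x : a @ F --> x -> \forall i \near F, `|a i| <= `|x| + 1.
Proof.
move=> /cvgrPdist_le/(_ 1 ltr01); apply: filterS => i xa.
by rewrite -[a i](subrK x) addrC (le_trans (ler_normD _ _))// lerD2l distrC.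
Qed.

Let near_phi_le1 a b : phi (a i) (b i) @[i --> F] --> (0 : R) ->
  \forall i \near F, Num.sqrt (phi (a i) (b i)) <= 1.
Proof.
move=> /cvgrPdist_le/(_ 1 ltr01); apply: filterS => i;
  rewrite sub0r normrN => ab.
by rewrite -(sqrtr1 R) ler_wsqrtr// (le_trans (ler_norm _) ab).
Qed.

Lemma cvg_of_phi_l a b x : b @ F --> x ->
  phi (a i) (b i) @[i --> F] --> (0 : R) -> a @ F --> x.
Proof.
move=> bx ab0.
have ab : a i - b i @[i --> F] --> (0 : E).
  apply: (@phi_cvg0_dist _ _ (`|x| + 2)) => //.
  apply: filterS2 (near_bound bx) (near_phi_le1 ab0) => i h1 h2.
  by have := norm_le_phi E_us (a i) (b i); split; lra.
have -> : a = (fun i => (a i - b i) + b i) by apply/funext => i; rewrite subrK.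
by rewrite -[x]add0r; exact: cvgD.
Qed.

Lemma cvg_of_phi_r a b x : a @ F --> x ->
  phi (a i) (b i) @[i --> F] --> (0 : R) -> b @ F --> x.
Proof.
move=> ax ab0.
have ab : a i - b i @[i --> F] --> (0 : E).
  apply: (@phi_cvg0_dist _ _ (`|x| + 2)) => //.
  apply: filterS2 (near_bound ax) (near_phi_le1 ab0) => i h1 h2.
  by have := norm_le_phi_r E_us (a i) (b i); split; lra.
have -> : b = (fun i => a i - (a i - b i)) by apply/funext => i; rewrite subKr.
by rewrite -[x]subr0; exact: cvgB.
Qed.

End phi_convergence.

Lemma within_infinite_proper (D : set nat) : infinite_set D ->
  ProperFilter (within D \oo).
Proof.
move=> Dinf; split; last exact: within_filter.
move=> [N _ DN]; apply: Dinf.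
apply: (@sub_finite_set _ _ `I_N); last exact: finite_II.
by move=> n Dn; rewrite /= ltnNge; apply/negP => Nn; exact: (DN n Nn Dn).
Qed.

(** * The iteration *)

Section iteration.
Context {R : realType} {E : completeNormedModType R}.
Hypotheses (E_us : uniformly_smooth E) (E_uc : uniformly_convex E).
Implicit Types (K B C : set E) (x y z s u v p : E).

Lemma phi_Jinv_comb p (a1 a2 a3 : R) (f1 f2 f3 : dual E) :
  0 <= a1 -> 0 <= a2 -> 0 <= a3 -> a1 + a2 + a3 = 1 ->
  phi p (Jinv (a1 *: f1 + a2 *: f2 + a3 *: f3)) <=
  a1 * phi p (Jinv f1) + a2 * phi p (Jinv f2) + a3 * phi p (Jinv f3).
Proof.
move=> a10 a20 a30 a1E.
rewrite /phi !(JinvK E_us E_uc) !(norm_Jinv E_us E_uc) !dualD !dualZ.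
set n := `|_ + _ + _|.
have n_le : n <= a1 * `|f1| + a2 * `|f2| + a3 * `|f3|.
  apply: le_trans (ler_normD _ _) _; apply: lerD.
    by apply: le_trans (ler_normD _ _) _; rewrite !normrZ !ger0_norm.
  by rewrite normrZ ger0_norm.
have n0 : 0 <= n by exact: normr_ge0.
have : n ^+ 2 <= (a1 * `|f1| + a2 * `|f2| + a3 * `|f3|) ^+ 2.
  by rewrite ler_pXn2r ?nnegrE// (le_trans n0).
have : (a1 * `|f1| + a2 * `|f2| + a3 * `|f3|) ^+ 2 <=
    a1 * `|f1| ^+ 2 + a2 * `|f2| ^+ 2 + a3 * `|f3| ^+ 2.
  rewrite -subr_ge0 (_ : _ - _ = a1 * a2 * (`|f1| - `|f2|) ^+ 2 +
    a1 * a3 * (`|f1| - `|f3|) ^+ 2 + a2 * a3 * (`|f2| - `|f3|) ^+ 2).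
    by rewrite !addr_ge0// mulr_ge0 ?sqr_ge0// mulr_ge0.
  by rewrite (_ : a1 = 1 - a2 - a3); [ring|lra].
move: (n ^+ 2) => n2; rewrite (_ : a1 = 1 - a2 - a3); [lra|lra].
Qed.

Definition phi_halfspace K y s : set E :=
  [set v | K v /\ phi v y <= phi v s].

Lemma phi_halfspace_closed K y s : closed K -> closed (phi_halfspace K y s).
Proof.
move=> cK; have -> : phi_halfspace K y s =
    K `&` (fun v => phi v y - phi v s) @^-1` [set a : R | a <= 0].
  by apply/seteqP; split => v [Kv]; rewrite /= subr_le0.
apply: closedI => //; apply: preimage_closed; last exact: closed_le.
by move=> v _; apply: cvgB; apply: cvg_phi => //; exact: cvg_cst.
Qed.

Lemma phi_halfspace_convex K y s :
  @convex_set R E K -> @convex_set R E (phi_halfspace K y s).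
Proof.
move=> vK v w t; rewrite !inE => -[Kv Hv] [Kw Hw].
have /andP[t0 t1] : 0 <= t%:num <= 1 by rewrite ge0 le1.
split; first by apply: (convex_setE vK Kv Kw); rewrite t0.
rewrite -subr_ge0 in t1.
have := ler_wpM2l t0 Hv; have := ler_wpM2l t1 Hw; rewrite /phi.
rewrite -[conv t v w]/(t%:num *: v + (1 - t%:num) *: w) !pairD !pairZ; lra.
Qed.

Section one_step.
Variables (C B : set E) (x1 : E) (f : dual E -> dual E -> R) (A T : E -> dual E)
  (a1 a2 a3 : R).
Hypotheses (JC_convex : @convex_set R (dual E) (J @` C)).
Hypotheses (f_eq : eq_bifunction (J @` C) f) (A_mono : monotone_on C A)
  (T_nonexp : gen_Jstar_nonexpansive C T).
Hypotheses (a1_gt0 : 0 < a1) (a2_gt0 : 0 < a2) (a3_gt0 : 0 < a3)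
  (a_sum : a1 + a2 + a3 = 1).

Lemma phi_step r s z u p : 0 < r -> EP_resolvent C f r s z ->
  VI_resolvent C A r s u -> EP C f p -> VI C A p -> FJ C T p ->
  phi p (Jinv (a1 *: J s + a2 *: J z + a3 *: T u)) +
    a2 * phi z s + a3 * phi u s <= phi p s.
Proof.
move=> r0 zE uV pE pV pT.
have := phi_Jinv_comb p (J s) (J z) (T u) (ltW a1_gt0) (ltW a2_gt0) (ltW
  a3_gt0) a_sum.
rewrite !(JK E_us E_uc).
have [Cu _] := uV; have := T_nonexp.2 u p Cu pT.
move=> /(ler_wpM2l (ltW a3_gt0)).
have := ler_wpM2l (ltW a2_gt0) (EP_resolvent_phi E_us f_eq r0 zE pE).
have := ler_wpM2l (ltW a3_gt0) (VI_resolvent_phi E_us A_mono r0 uV pV).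
move: (phi p (Jinv (_ + _))) => n;
  have -> : a1 = 1 - a2 - a3 by rewrite -a_sum; ring.
lra.
Qed.

End one_step.

Definition projection_state C B x1 K x :=
  [/\ closed K, @convex_set R E K, K `<=` C, B `<=` K &
    K x /\ forall y, K y -> phi x x1 <= phi y x1].

Lemma projection_state_step C B x1 K x y s : B !=set0 ->
  projection_state C B x1 K x ->
  (forall p, B p -> phi p y <= phi p s) ->
  exists2 x', gen_proj (phi_halfspace K y s) x1 = [set x'] &
    projection_state C B x1 (phi_halfspace K y s) x'.
Proof.
move=> [p Bp] [cK vK KC BK _] Bys.
have BK' : B `<=` phi_halfspace K y s by move=> q Bq; split;
  [exact: BK|exact: Bys].
have [|x' [Kx' x'min x'E]] := gen_proj_exists E_us E_uc x1 _
  (phi_halfspace_closed (y := y) (s := s) cK) (phi_halfspace_convex vK).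
  by exists p; exact: BK'.
exists x' => //; split => //.
- exact: phi_halfspace_closed.
- exact: phi_halfspace_convex.
- by move=> v [/KC].
Qed.

End iteration.

Section scheme_properties.
Context {R : realType} {E : completeNormedModType R}.
Hypotheses (E_us : uniformly_smooth E) (E_uc : uniformly_convex E).
Variables (C : set E).
Hypotheses (C0 : C !=set0) (C_closed : closed C) (C_convex : @convex_set R E C).
Hypothesis JC_convex : @convex_set R (dual E) (J @` C).
Variables (f : nat -> dual E -> dual E -> R) (A T : nat -> E -> dual E).
Variable Gamma : set (E -> dual E).
Hypotheses (f_eq : forall i, eq_bifunction (J @` C) (f i))
  (A_cont : forall j, {within C, continuous (A j)})
  (A_mono : forall j, monotone_on C (A j))
  (T_nonexp : forall n, gen_Jstar_nonexpansive C (T n))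
  (Gamma_closed : forall S, Gamma S -> Jstar_closed C S)
  (FJ_eq : \bigcap_n FJ C (T n) = \bigcap_(S in Gamma) FJ C S)
  (T_NST : NST_condition C T Gamma).
Let B := common_solutions C Gamma f A.
Hypotheses (B0 : B !=set0) (B_closed : closed B) (B_convex : @convex_set R E B).
Variables (mu nu : nat -> nat).
Hypotheses (mu_inf : forall i, infinite_set [set n | mu n = i])
  (nu_inf : forall j, infinite_set [set n | nu n = j]).
Variables (h : E -> E) (rho : R) (ubar : E) (lambda sigma : nat -> R).
Hypotheses (h_contr : rho.-lipschitz_C h)
  (lambda_cvg : lambda n @[n --> \oo] --> (0 : R))
  (sigma_cvg : sigma n @[n --> \oo] --> (0 : R)).
Variables (a1 a2 a3 : R) (r : nat -> R) (a : R) (x1 : E).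
Hypotheses (a1_gt0 : 0 < a1) (a2_gt0 : 0 < a2) (a3_gt0 : 0 < a3)
  (a_sum : a1 + a2 + a3 = 1) (a_gt0 : 0 < a) (r_ge : forall n, a <= r n)
  (C_x1 : C x1).

Let run := scheme_upto C h ubar lambda sigma a1 a2 a3 r mu nu f A T x1.

Let r_gt0 n : 0 < r n. Proof. exact: lt_le_trans (r_ge n). Qed.

Let B_sub p : B p -> [/\ C p, forall n, FJ C (T n) p, forall i, EP C (f i) p &
  forall j, VI C (A j) p].
Proof.
move=> [[pG pE] pV]; have pT n : FJ C (T n) p by move: pG; rewrite -FJ_eq;
  apply.
split => //; first by case: (pT 0%N).
- by move=> i; exact: pE.
- by move=> j; exact: pV.
Qed.

Let step_ge p s z u n : B p ->
  EP_resolvent C (f (mu n)) (r n) s z -> VI_resolvent C (A (nu n)) (r n) s u ->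
  phi p (Jinv (a1 *: J s + a2 *: J z + a3 *: T n u)) +
    a2 * phi z s + a3 * phi u s <= phi p s.
Proof.
move=> /B_sub[_ pT pE pV] zE uV.
exact: (phi_step E_us E_uc (f_eq (mu n)) (A_mono (nu n)) (T_nonexp n)
  a1_gt0 a2_gt0 a3_gt0 a_sum (r_gt0 n) zE uV).
Qed.

Let step_half p s z u n : B p ->
  EP_resolvent C (f (mu n)) (r n) s z -> VI_resolvent C (A (nu n)) (r n) s u ->
  phi p (Jinv (a1 *: J s + a2 *: J z + a3 *: T n u)) <= phi p s.
Proof.
move=> Bp zE uV; have := step_ge Bp zE uV.
have := mulr_ge0 (ltW a2_gt0) (phi_ge0 E_us z s).
have := mulr_ge0 (ltW a3_gt0) (phi_ge0 E_us u s); lra.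
Qed.

Let run_state N w : run N w -> forall n, (n <= N)%N ->
  projection_state C B x1 (it_C w n) (it_x w n).
Proof.
move=> [w0 wC wS]; elim=> [_|n IH nN].
  rewrite w0 wC; split => //; first by move=> p /B_sub[].
  by split => // y _; rewrite (phixx E_us) (phi_ge0 E_us).
have [_ zE uE yE [CE xE]] := wS n nN.
have Ez : EP_resolvent C (f (mu n)) (r n) (it_s w n) (it_z w n) by rewrite zE.
have Vu : VI_resolvent C (A (nu n)) (r n) (it_s w n) (it_u w n) by rewrite uE.
have [|x' x'E st] := projection_state_step E_us E_uc (y := it_y w n)
    (s := it_s w n) B0 (IH (ltnW nN)).
  by move=> p Bp; rewrite yE; exact: step_half.
rewrite CE; suff -> : it_x w n.+1 = x' by [].
have : [set x'] (it_x w n.+1) by rewrite -x'E -[phi_halfspace _ _ _]CE xE.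
by [].
Qed.

Lemma scheme_unique w w' : (forall N, run N w) -> (forall N, run N w') ->
  it_x w' = it_x w.
Proof.
move=> Rw Rw'; apply/funext => n.
suff [] : it_x w' n = it_x w n /\ it_C w' n = it_C w n by [].
elim: n => [|n [IHx IHC]].
  by have [-> -> _] := Rw 0%N; have [-> -> _] := Rw' 0%N.
have [_ _ /(_ n (leqnn _))[sE zE uE yE [CE xE]]] := Rw n.+1.
have [_ _ /(_ n (leqnn _))[sE' zE' uE' yE' [CE' xE']]] := Rw' n.+1.
have ss : it_s w' n = it_s w n by rewrite sE' sE IHx.
have zz : it_z w' n = it_z w n.
  by have : [set it_z w n] (it_z w' n) by rewrite -zE -ss zE'.
have uu : it_u w' n = it_u w n.
  by have : [set it_u w n] (it_u w' n) by rewrite -uE -ss uE'.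
have yy : it_y w' n = it_y w n by rewrite yE' yE ss zz uu.
have CC : it_C w' n.+1 = it_C w n.+1 by rewrite CE' CE IHC yy ss.
split => //.
by have : [set it_x w n.+1] (it_x w' n.+1) by rewrite -xE -CC xE'.
Qed.

Lemma scheme_exists : (forall N w, run N w ->
    EP_resolvent C (f (mu N)) (r N)
      (scheme_s h ubar lambda sigma N (it_x w N)) !=set0) ->
  exists w, forall N, run N w.
Proof.
move=> EP0.
pose s_ n x := scheme_s h ubar lambda sigma n x.
pose z_ n x := get (EP_resolvent C (f (mu n)) (r n) (s_ n x)).
pose u_ n x := get (VI_resolvent C (A (nu n)) (r n) (s_ n x)).
pose y_ n x := Jinv (a1 *: J (s_ n x) + a2 *: J (z_ n x) + a3 *: T n (u_ n x)).
pose K_ n x K := phi_halfspace K (y_ n x) (s_ n x).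
pose fix st n : E * set E := if n is n'.+1 then
  let p := st n' in (get (gen_proj (K_ n' p.1 p.2) x1), K_ n' p.1 p.2) else
    (x1, C).
pose x n := (st n).1.
pose w := Iterates x (fun n => s_ n (x n)) (fun n => z_ n (x n))
  (fun n => u_ n (x n)) (fun n => y_ n (x n)) (fun n => (st n).2).
exists w; elim=> [|N IH]; first by [].
case: (IH) => w0 wC wS; split => // n;
  rewrite ltnS leq_eqVlt => /orP[/eqP ->|]; last first.
  exact: wS.
have [z zE] := EP0 _ _ IH.
have {}zE : EP_resolvent C (f (mu N)) (r N) (s_ N (x N)) = [set z].
  apply/seteqP; split => [z' z'E|_ -> //].
  exact: (EP_resolvent_unique E_us E_uc (f_eq (mu N)) (r_gt0 N) z'E zE).
have [u uE] := VI_resolvent_exists E_us E_uc C0 C_closed C_convex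
  (@A_cont (nu N)) (A_mono (nu N)) (s_ N (x N)) (r_gt0 N).
have zz : z_ N (x N) = z by rewrite /z_ zE; exact: (@getI _ [set z] z).
have uu : u_ N (x N) = u by rewrite /u_ uE; exact: (@getI _ [set u] u).
have [|x' x'E _] := projection_state_step E_us E_uc (y := y_ N (x N))
    (s := s_ N (x N)) B0 (run_state IH (leqnn N)).
  by move=> p Bp; rewrite /y_; apply: step_half; rewrite // ?zE ?uE ?zz ?uu.
split => //.
- by rewrite zE /= zz.
- by rewrite uE /= uu.
- split => //; rewrite [LHS]x'E; congr [set _].
  rewrite (_ : it_x w N.+1 = get (gen_proj (phi_halfspace (it_C w N)
    (y_ N (x N)) (s_ N (x N))) x1))// x'E.
  by apply/esym; exact: (@getI _ [set x'] x').
Qed.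

Lemma scheme_cvg w p : (forall N, run N w) -> B p ->
  (forall q, B q -> phi p x1 <= phi q x1) -> it_x w n @[n --> \oo] --> p.
Proof.
move=> Rw Bp pmin.
pose x := it_x w; pose s := it_s w; pose z := it_z w; pose u := it_u w.
pose y := it_y w; pose K := it_C w.
have squeeze0 (c d : nat -> R) : (forall n, 0 <= c n <= d n) ->
    d @ \oo --> (0 : R) -> c @ \oo --> (0 : R).
  move=> cd d0; apply: (@squeeze_cvgr _ _ _ _ (fun=> 0) d c _ 0) => //.
    exact: nearW.
  exact: cvg_cst.
have st n : projection_state C B x1 (K n) (x n) := run_state (Rw n) (leqnn n).
have stepE n := let: And3 _ _ H := Rw n.+1 in H n (leqnn _).
have sE n : s n = scheme_s h ubar lambda sigma n (x n) by case: (stepE n).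
have zE n : EP_resolvent C (f (mu n)) (r n) (s n) (z n).
  by case: (stepE n) => _ ->.
have uE n : VI_resolvent C (A (nu n)) (r n) (s n) (u n).
  by case: (stepE n) => _ _ ->.
have yE n : y n = Jinv (a1 *: J (s n) + a2 *: J (z n) + a3 *: T n (u n)).
  by case: (stepE n).
have KE n : K n.+1 = phi_halfspace (K n) (y n) (s n).
  by case: (stepE n) => _ _ _ _ [].
have Cz n : C (z n) by case: (zE n).
have Cu n : C (u n) by case: (uE n).
have Kx n : K n (x n) by case: (st n) => _ _ _ _ [].
have xmin n v : K n v -> phi (x n) x1 <= phi v x1.
  by case: (st n) => _ _ _ _ [_]; apply.
have Kdec n m : (n <= m)%N -> K m `<=` K n.
  move=> /subnK <-; elim: (m - n)%N => [//|k IH]; rewrite addSn KE.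
  by move=> v [Kv _]; exact: IH.
have Kp n : K n p by case: (st n) => _ _ _ BK _; exact: BK.
have Cx n : C (x n) by case: (st n) => _ _ KC _ _; exact: KC.
have x_phi n m : (n <= m)%N -> phi (x m) (x n) + phi (x n) x1 <= phi (x m) x1.
  move=> nm; have [_ vK _ _ _] := st n.
  by apply: (gen_proj_ineq E_us vK (Kx n) (xmin n)); exact: Kdec nm _ (Kx m).
have x_bd n : `|x n| <= `|x1| + Num.sqrt (phi p x1).
  apply: le_trans (norm_le_phi E_us _ x1) _; rewrite lerD2l ler_wsqrtr//.
  exact: xmin.
pose S := [set phi (x n) x1 | n in [set: nat]].
have supS : has_sup S.
  split; first by exists (phi (x 0%N) x1), 0%N.
  by exists (phi p x1) => _ [n _ <-]; exact: xmin.
have x_cauchy : cauchy (x @ \oo).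
  apply: cauchy_exP => e e0.
  have [d d0 dP] := phi_small E_us E_uc (`|x1| + Num.sqrt (phi p x1)) e0.
  have [_ [N _ <-] SN] := sup_adherent d0 supS.
  exists (x N), N => // n /= Nn; rewrite -ball_normE /ball_/= distrC.
  apply: dP => //; have := x_phi N n Nn.
  by have := ub_le_sup supS.2 (ex_intro2 _ _ n I erefl); lra.
have [xs x_xs] : exists xs : E, x @ \oo --> xs.
  by exists (lim (x @ \oo)); exact: (@cauchy_cvg E _ _ x_cauchy).
have Cxs : C xs.
  by apply: (@closed_cvg _ _ \oo _ x C C_closed _ _ x_xs); exact: nearW.
have hx : h (x n) @[n --> \oo] --> h xs.
  apply/cvgrPdist_le => /= e e0; near=> n.
  have /= := h_contr (conj Cxs (Cx n) : (C `*` C) (xs, x n)).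
  move=> /le_trans; apply.
  apply: (@le_trans _ _ ((`|rho| + 1) * `|xs - x n|)).
    by rewrite ler_wpM2r// (le_trans (ler_norm _))// lerDl.
  rewrite mulrC -ler_pdivlMr ?ltr_wpDl//; near: n.
  move/cvgrPdist_le: x_xs; apply.
  by rewrite divr_gt0// ltr_wpDl.
have Jx : J (x n) @[n --> \oo] --> J xs by exact: cvg_J.
have s_xs : s @ \oo --> xs.
  have -> : s = fun n => scheme_s h ubar lambda sigma n (x n) by apply/funext.
  rewrite -[xs](JK E_us E_uc); apply: cvg_Jinv => //.
  rewrite -[X in _ --> X]scale1r -[X in _ --> X *: _](subr0 1).
  rewrite -[X in _ --> X *: _](subr0 (1 - 0)).
  rewrite -[X in _ --> X]add0r -[X in _ --> X + _]addr0.
  rewrite -[X in _ --> X + _ + _](scale0r (J (h xs))).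
  rewrite -[X in _ --> _ + X + _](scale0r (J ubar)).
  apply: cvgD; [apply: cvgD|].
  - by apply: cvgZ => //; exact: cvg_J.
  - exact: cvgZr_tmp.
  - apply: cvgZ => //; apply: cvgB => //; apply: cvgB => //; exact: cvg_cst.
have phi_ys : phi (x n.+1) (y n) @[n --> \oo] --> (0 : R).
  have xS : x n.+1 @[n --> \oo] --> xs by rewrite (cvg_shiftS x).
  have xs0 : phi (x n.+1) (s n) @[n --> \oo] --> (0 : R).
    by rewrite -(phixx E_us xs); exact: cvg_phi.
  apply: (squeeze0 _ _ _ xs0) => n; rewrite phi_ge0//=.
  by have := Kx n.+1; rewrite KE => -[].
have y_xs : y @ \oo --> xs.
  have xS : x n.+1 @[n --> \oo] --> xs by rewrite (cvg_shiftS x).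
  exact: (cvg_of_phi_r E_us E_uc xS phi_ys).
have psy : phi p (s n) - phi p (y n) @[n --> \oo] --> (0 : R).
  by rewrite -(subrr (phi p xs)); apply: cvgB; apply: cvg_phi => //;
    exact: cvg_cst.
have phi_zs : phi (z n) (s n) @[n --> \oo] --> (0 : R).
  have ps0 : a2^-1 * (phi p (s n) - phi p (y n)) @[n --> \oo] --> (0 : R).
    by rewrite -(mulr0 a2^-1); exact: cvgMr.
  apply: (squeeze0 _ _ _ ps0) => n.
  rewrite phi_ge0//= ler_pdivlMl//.
  have := step_ge Bp (zE n) (uE n); rewrite -yE.
  by have := mulr_ge0 (ltW a3_gt0) (phi_ge0 E_us (u n) (s n)); lra.
have phi_us : phi (u n) (s n) @[n --> \oo] --> (0 : R).
  have ps0 : a3^-1 * (phi p (s n) - phi p (y n)) @[n --> \oo] --> (0 : R).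
    by rewrite -(mulr0 a3^-1); exact: cvgMr.
  apply: (squeeze0 _ _ _ ps0) => n.
  rewrite phi_ge0//= ler_pdivlMl//.
  have := step_ge Bp (zE n) (uE n); rewrite -yE.
  by have := mulr_ge0 (ltW a2_gt0) (phi_ge0 E_us (z n) (s n)); lra.
have z_xs : z @ \oo --> xs.
  exact: (cvg_of_phi_l E_us E_uc s_xs phi_zs).
have u_xs : u @ \oo --> xs.
  exact: (cvg_of_phi_l E_us E_uc s_xs phi_us).
have Js : J (s n) @[n --> \oo] --> J xs by exact: cvg_J.
have Jy : J (y n) @[n --> \oo] --> J xs by exact: cvg_J.
have Jz : J (z n) @[n --> \oo] --> J xs by exact: cvg_J.
have Ju : J (u n) @[n --> \oo] --> J xs by exact: cvg_J.
have Tu : T n (u n) @[n --> \oo] --> J xs.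
  have -> : (fun n => T n (u n)) =
      fun n => a3^-1 *: (J (y n) - a1 *: J (s n) - a2 *: J (z n)).
    apply/funext => n; rewrite yE (JinvK E_us E_uc) -addrA -opprD.
    by rewrite [X in X - _]addrC addrK scalerA mulVf ?scale1r// gt_eqF.
  rewrite -[X in _ --> X]scale1r (_ : 1 = a3^-1 * (1 - a1 - a2)); last first.
    rewrite (_ : 1 - a1 - a2 = a3) ?mulVf ?gt_eqF//.
    by rewrite -a_sum; ring.
  rewrite -scalerA !scalerBl scale1r.
  apply: cvgZl_tmp; apply: cvgB; last exact: cvgZl_tmp.
  by apply: cvgB => //; exact: cvgZl_tmp.
have JTu : `|J (u n) - T n (u n)| @[n --> \oo] --> (0 : R).
  have : J (u n) - T n (u n) @[n --> \oo] --> J xs - J xs by exact: cvgB.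
  by move/cvg_norm; rewrite subrr normr0.
have u_bd : bounded_set (range u).
  have [M [Mr uM]] := cvg_seq_bounded (cvgP xs u_xs).
  by exists M; split => // M' MM' _ [n _ <-]; exact: (uM M' MM' n).
have xsF G : Gamma G -> FJ C G xs.
  move=> GS; have JSu := T_NST Cu u_bd JTu GS.
  have Su : G (u n) @[n --> \oo] --> J xs.
    have JSu0 : J (u n) - G (u n) @[n --> \oo] --> (0 : dual E).
      apply/cvgrPdist_lt => /= e e0.
      move/cvgrPdist_lt: JSu => /(_ e e0); apply: filterS => n.
      by rewrite !sub0r !normrN normr_id.
    have -> : (fun n => G (u n)) = fun n => J (u n) - (J (u n) - G (u n)).
      by apply/funext => n; rewrite subKr.
    by rewrite -[X in _ --> X]subr0; exact: cvgB.
  have JSu' : Jinv (G (u n)) @[n --> \oo] --> xs.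
    by rewrite -[X in _ --> X](JK E_us E_uc); exact: cvg_Jinv.
  have := Gamma_closed GS Cu u_xs JSu' => SE.
  by split => //; rewrite -[LHS](JinvK E_us E_uc) SE.
pose c v n := (r n)^-1 * (J (z n) - J (s n)) (v - z n).
pose d v n := (r n)^-1 * (J (u n) - J (s n)) (v - u n).
have inv_r (e : nat -> R) : e @ \oo --> (0 : R) ->
    (r n)^-1 * e n @[n --> \oo] --> (0 : R).
  move=> e0; apply/norm_cvg0P.
  have ae : a^-1 * `|e n| @[n --> \oo] --> (0 : R).
    by rewrite -(mulr0 a^-1); apply: cvgMr; apply/norm_cvg0P.
  apply: (squeeze0 _ _ _ ae) => n; rewrite normr_ge0 normrM/= ler_wpM2r//.
  by rewrite ger0_norm ?invr_ge0 ?(ltW (r_gt0 n))// lef_pV2 ?posrE.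
have cd0 (v_ : nat -> E) v : v_ @ \oo --> xs ->
    J (v_ n) @[n --> \oo] --> J xs ->
    (r n)^-1 * (J (v_ n) - J (s n)) (v - v_ n) @[n --> \oo] --> (0 : R).
  move=> vxs Jv; apply: (inv_r (fun n => (J (v_ n) - J (s n)) (v - v_ n))).
  have -> : (0 : R) = (J xs - J xs) (v - xs) by rewrite subrr.
  apply: cvg_dual_app; first exact: cvgB.
  by apply: cvgB => //; exact: cvg_cst.
have Bxs : B xs.
  split; first split.
  - by move=> G GG; exact: xsF.
  - move=> i _; have PF := within_infinite_proper (@mu_inf i).
    apply: (@EP_limit _ _ E_us _ _ JC_convex (f_eq i) _ _ PF z c xs Cxs).
    + rewrite near_withinE; apply: nearW => n /= <-.
      by have [Czn Hn] := zE n; split.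
    + exact: cvg_within_filter z_xs.
    + by move=> v _; apply: cvg_within_filter; exact: cd0.
  - move=> j _; split => // v Cv.
    have PF := within_infinite_proper (@nu_inf j).
    have lim : A j (u n) (v - u n) + d v n @[n --> within [set n | nu n = j]
      \oo] -->
        A j xs (v - xs).
      rewrite -[X in _ --> X]addr0; apply: cvgD.
        apply: cvg_dual_app.
          apply: (cvg_within_continuous (C := C)) => //.
            exact: nearW.
          exact: cvg_within_filter u_xs.
        apply: cvgB; first exact: cvg_cst.
        exact: cvg_within_filter u_xs.
      by apply: cvg_within_filter; exact: cd0.
    apply: (@closed_cvg _ _ _ PF _ [set t : R | 0 <= t] (@closed_ge _ _) _ _
      lim).
    rewrite near_withinE; apply: nearW => n /= <-.
    by have [_ Hn] := uE n; exact: Hn.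
have xs_le : phi xs x1 <= phi p x1.
  apply: (@closed_cvg _ _ \oo _ (fun n => phi (x n) x1) [set t : R | t <= phi p
    x1]
    (@closed_le _ _)).
    by apply: nearW => n; exact: xmin.
  by apply: cvg_phi => //; exact: cvg_cst.
suff <- : xs = p by [].
apply: (phi_eq0 E_us E_uc); apply/eqP; rewrite eq_le phi_ge0// andbT.
by have := gen_proj_ineq E_us B_convex Bp pmin Bxs; lra.
Unshelve. all: by end_near. Qed.

End scheme_properties.

Theorem theorem3p1 (R : realType) (E : completeNormedModType R)
  (E_smooth : uniformly_smooth E) (E_convex : uniformly_convex E)
  (C : set E) (C0 : C !=set0) (C_closed : closed C)
  (C_convex : @convex_set R E C)
  (JC_closed : closed (J @` C)) (JC_convex : @convex_set R (dual E) (J @` C))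
  (f : nat -> dual E -> dual E -> R)
  (f_eq : forall i, eq_bifunction (J @` C) (f i))
  (A : nat -> E -> dual E)
  (A_cont : forall j, {within C, continuous (A j)})
  (A_mono : forall j, monotone_on C (A j))
  (T : nat -> E -> dual E)
  (T_nonexp : forall n, gen_Jstar_nonexpansive C (T n))
  (Gamma : set (E -> dual E))
  (Gamma_closed : forall S, Gamma S -> Jstar_closed C S)
  (Gamma_nonexp : forall S, Gamma S -> gen_Jstar_nonexpansive C S)
  (FJ_eq : \bigcap_n FJ C (T n) = \bigcap_(S in Gamma) FJ C S)
  (FJ0 : \bigcap_(S in Gamma) FJ C S !=set0)
  (T_NST : NST_condition C T Gamma)
  (B0 : common_solutions C Gamma f A !=set0)
  (B_closed : closed (common_solutions C Gamma f A))
  (B_convex : @convex_set R E (common_solutions C Gamma f A))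
  (mu nu : nat -> nat)
  (mu_inf : forall i, infinite_set [set n | mu n = i])
  (nu_inf : forall j, infinite_set [set n | nu n = j])
  (h : E -> E) (rho : R) (h_self : forall x, C x -> C (h x))
  (rho01 : 0 < rho < 1) (h_contr : rho.-lipschitz_C h)
  (ubar : E) (C_ubar : C ubar)
  (lambda sigma : nat -> R)
  (lambda01 : forall n, 0 <= lambda n < 1)
  (sigma01 : forall n, 0 <= sigma n < 1)
  (lambda_sigma : forall n, lambda n + sigma n < 1)
  (lambda_cvg : lambda n @[n --> \oo] --> (0 : R))
  (sigma_cvg : sigma n @[n --> \oo] --> (0 : R))
  (a1 a2 a3 : R) (a1_01 : 0 < a1 < 1) (a2_01 : 0 < a2 < 1)
  (a3_01 : 0 < a3 < 1) (a_sum : a1 + a2 + a3 = 1)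
  (r : nat -> R) (a : R) (a_gt0 : 0 < a) (r_ge : forall n, a <= r n)
  (x1 : E) (C_x1 : C x1) :
  let run := scheme_upto C h ubar lambda sigma a1 a2 a3 r mu nu f A T x1 in
  (* The line defining z_n presupposes that its set is nonempty at the points
     s_n actually reached; see the comment on EP_resolvent. *)
  (forall N w, run N w ->
    EP_resolvent C (f (mu N)) (r N)
      (scheme_s h ubar lambda sigma N (it_x w N)) !=set0) ->
  exists w : iterates E,
    [/\ forall N, run N w,
        forall w', (forall N, run N w') -> it_x w' = it_x w
      & exists2 p : E,
          gen_proj (common_solutions C Gamma f A) x1 = [set p] &
          it_x w n @[n --> \oo] --> p].
Proof.
move=> run EP0.
have a1_gt0 : 0 < a1 by case/andP: a1_01.
have a2_gt0 : 0 < a2 by case/andP: a2_01.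
have a3_gt0 : 0 < a3 by case/andP: a3_01.
have [w Rw] := scheme_exists E_smooth E_convex C0 C_closed C_convex f_eq A_cont
  A_mono T_nonexp FJ_eq B0 a1_gt0 a2_gt0 a3_gt0 a_sum a_gt0 r_ge C_x1 EP0.
have [p [Bp pmin pE]] :=
  gen_proj_exists E_smooth E_convex x1 B0 B_closed B_convex.
exists w; split => //.
  by move=> w' Rw'; exact: scheme_unique Rw Rw'.
exists p => //.
exact: (scheme_cvg E_smooth E_convex C_closed C_convex JC_convex f_eq A_cont
  A_mono T_nonexp Gamma_closed FJ_eq T_NST B0 B_convex mu_inf nu_inf h_contr
  lambda_cvg sigma_cvg a1_gt0 a2_gt0 a3_gt0 a_sum a_gt0 r_ge C_x1 Rw Bp pmin).
Qed.
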